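(* Let $\boldsymbol{\mu}\colon\mathbb{N}\to\{-1,0,1\}$ be the Möbius function. Assume Sarnak's conjecture holds, i.e. for every topological dynamical system $(X,T)$ ($X$ a compact metric space, $T\colon X\to X$ continuous) of zero topological entropy, every $x\in X$ and every continuous $f\colon X\to\mathbb{C}$, $$\lim_{N\to\infty}\frac1N\sum_{n=1}^{N} f(T^n x)\,\boldsymbol{\mu}(n)=0.$$ Then there exists an increasing sequence $(N_i)$ of positive integers along which the Chowla conjecture holds: for every $k\ge 0$, every $1\le a_1<\dots<a_k$ and every choice of $j_0,j_1,\dots,j_k\in\{1,2\}$ not all equal to $2$, $$\lim_{i\to\infty}\frac1{N_i}\sum_{n\le N_i}\boldsymbol{\mu}^{j_0}(n)\,\boldsymbol{\mu}^{j_1}(n+a_1)\cdots\boldsymbol{\mu}^{j_k}(n+a_k)=0.$$ *)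

(* Defs.v *)
From HB Require Import structures.
From mathcomp Require Import all_boot all_order all_algebra.
From mathcomp Require Import all_classical all_reals all_analysis.
Set Implicit Arguments. Unset Strict Implicit. Unset Printing Implicit Defensive.
Import Order.TTheory GRing.Theory Num.Theory.
Import numFieldNormedType.Exports.
Local Open Scope classical_set_scope.
Local Open Scope ring_scope.

(* Moebius function: mu 0 = 0 (irrelevant: only n >= 1 is used),
   mu n = (-1)^(number of prime factors) if n is squarefree, 0 otherwise. *)
Definition moebius (n : nat) : int :=
  if (0 < n)%N && all (fun p => logn p n <= 1)%N (primes n)
  then (-1) ^+ size (primes n) else 0.

Definition separated (R : realType) (X : pseudoMetricType R) (T : X -> X)
  (n : nat) (eps : R) (m : nat) (s : 'I_m -> X) : Prop :=
  forall i j : 'I_m, i != j ->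
    exists2 t : nat, (t < n)%N & ~ ball (iter t T (s i)) eps (iter t T (s j)).

(* Zero topological entropy (Bowen): for every eps > 0,
   limsup_n (1/n) log s(n,eps) <= 0, where s(n,eps) is the maximal cardinality
   of an (n,eps)-separated set; written out: for every delta > 0, eventually
   every (n,eps)-separated set has at most exp(delta n) elements. *)
Definition zero_entropy (R : realType) (X : pseudoMetricType R) (T : X -> X)
  : Prop :=
  forall eps : R, 0 < eps -> forall delta : R, 0 < delta ->
    exists N0 : nat, forall n : nat, (N0 <= n)%N ->
      forall (m : nat) (s : 'I_m -> X), separated T n eps s ->
        (m%:R <= expR (delta * n%:R))%R.

Definition avg (R : realType) (g : nat -> R) (N : nat) : R :=
  (N%:R)^-1 * \sum_(1 <= n < N.+1) g n.

(* Sarnak's conjecture, for continuous complex-valued f written as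
   f = fre + i fim with fre, fim continuous real-valued. *)
Definition sarnak (R : realType) : Prop :=
  forall (X : pseudoMetricType R), hausdorff_space X -> compact [set: X] ->
  forall T : X -> X, continuous T -> zero_entropy T ->
  forall (x : X) (fre fim : X -> R), continuous fre -> continuous fim ->
    (avg (fun n => fre (iter n T x) * (moebius n)%:~R) @ \oo --> (0 : R)) /\
    (avg (fun n => fim (iter n T x) * (moebius n)%:~R) @ \oo --> (0 : R)).

Definition chowla_term (k : nat) (a : 'I_k -> nat) (j0 : nat)
  (j : 'I_k -> nat) (n : nat) : int :=
  moebius n ^+ j0 * \prod_(t < k) moebius (n + a t) ^+ j t.

(* Main.v *)
(** Fix an ultrafilter limit E of logarithmic averages; it is invariant under
    n -> n + 1 and satisfies E [1_(p | n) g (n / p)] = E g / p exactly.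

    Step 1. Sarnak's conjecture makes mu asymptotically orthogonal under E to
    every function of n mod q and of (mu (n + j)), j >= w, as w tends to
    infinity.  Otherwise extremal predictors from the futures j >= w form a
    Cauchy sequence; their limit is a tail event, so (Rokhlin-Sinai) its entropy
    rate vanishes, and realising it along a rapidly growing sequence of stages
    gives a sequence whose orbit closure has zero topological entropy and which
    correlates with mu.

    Step 2. Let C n = psi n * mu n * mu (n + h_1) ... with psi periodic and
    h_i > 0.  Since mu (p m) = - mu m for p not dividing m, dilating by a prime
    p gives E C / p = +- E [mu n * phi_p n] up to O (1 / p^2), where
    phi_p n = 1_(p | n) psi (n / p) mu (n + p h_1) ... only looks at the future
    j >= p.  Sum over the primes p > w in a range with S = sum 1/p >= 1/2: the
    second moment of Phi = sum_p phi_p is at most S^2 + S, so Step 1 applies to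
    Phi / S and E C = 0.

    Step 3. For a Chowla pattern C, averaging over shifts and Step 2 give
    E [A_N (C)^2] = 0 for the Cesaro averages A_N (C), so finitely many patterns
    are simultaneously small for some large N; a diagonal argument concludes. *)

Require Import Defs.
From HB Require Import structures.
From mathcomp Require Import all_boot all_order all_algebra.
From mathcomp Require Import all_classical all_reals all_analysis.
From mathcomp Require Import ring lra zify.
Import Order.TTheory GRing.Theory Num.Theory.
Import numFieldNormedType.Exports.
Local Open Scope classical_set_scope.
Local Open Scope ring_scope.
Set Implicit Arguments. Unset Strict Implicit. Unset Printing Implicit Defensive.

(** Sarnak's hypothesis concerns Cesaro averages, but dilation by p relates averages up to N to
    averages up to N / p; logarithmic means identify the two scales. Dilation fixes the site 0 and
    moves a positive site h to p h >= p, so a pattern becomes mu n times a function of the far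
    future: hence futures in Step 1 and positive h_i in Step 2. Step 1 carries no rate in w, so w is
    fixed before the primes are chosen beyond it, and only the second moment of Phi is controlled,
    not its supremum. The diagonal part S of that moment is harmless because S >= 1/2 gives S <= 2
    S^2.

    [E] is only finitely additive: there is no measure space and no conditional expectation. Entropy
    is therefore computed for finite-valued sequences, and the tail event of Step 1 exists only as a
    Cauchy sequence of predictors until gluing turns it into an actual 0-1 sequence. What comes out
    at the end is the vanishing of [E] on squared Cesaro averages, which produces good N but not all
    N; hence a subsequence. *)

Lemma exists_nat_gt (R : realType) (x : R) : exists n : nat, x < n%:R.
Proof. by exists (Num.truncn x).+1; exact: truncnS_gt. Qed.

(** * Logarithmic means *)

Section LogMean.
Context {R : realType}.
Implicit Types (f g : nat -> R) (c e : R) (N n : nat).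

Definition harm N : R := \sum_(1 <= n < N.+1) n%:R^-1.
Definition lavg g N : R := (harm N)^-1 * \sum_(1 <= n < N.+1) g n / n%:R.
Definition bdd g := exists M : R, forall n, `|g n| <= M.

(* Finitely additive means dominated by the upper limit of the logarithmic
   averages. *)
Record logmean (E : (nat -> R) -> R) : Prop := LogMean {
  lmD : forall f g, bdd f -> bdd g -> E (fun n => f n + g n) = E f + E g;
  lmZ : forall c f, bdd f -> E (fun n => c * f n) = c * E f;
  lm_le : forall g c N0, bdd g ->
    (forall N, (N0 <= N)%N -> lavg g N <= c) -> E g <= c }.

Lemma harmE N : harm N = series harmonic N.
Proof.
rewrite /harm /series /= big_add1 /=; exact: eq_bigr.
Qed.

Lemma harm_ge0 N : 0 <= harm N.
Proof. by apply: sumr_ge0 => i _; rewrite invr_ge0. Qed.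

Lemma harm_gt0 N : (0 < N)%N -> 0 < harm N.
Proof.
case: N => // N _; rewrite /harm big_nat_recl //= ltr_wpDr //.
by apply: sumr_ge0 => i _; rewrite invr_ge0.
Qed.

Lemma harm_unbounded c : exists N0, forall N, (N0 <= N)%N -> c <= harm N.
Proof.
have nd : {homo @series R harmonic : n m / (n <= m)%N >-> n <= m}.
  move=> n m nm; apply: (@nondecreasing_series R _ predT) => // k _ _.
  exact: harmonic_ge0.
have /cvgryPge/(_ c)[N0 _ H] := nondecreasing_dvgn_lt nd (@dvg_harmonic R).
by exists N0 => N /H /=; rewrite harmE.
Qed.

Lemma bdd_cst c : bdd (fun=> c).
Proof. by exists `|c|. Qed.

Lemma bddD f g : bdd f -> bdd g -> bdd (fun n => f n + g n).
Proof.
by move=> [M HM] [K HK]; exists (M + K) => n; rewrite (le_trans (ler_normD _ _)) ?lerD.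
Qed.

Lemma bddN f : bdd f -> bdd (fun n => - f n).
Proof. by move=> [M HM]; exists M => n; rewrite normrN. Qed.

Lemma bddM f g : bdd f -> bdd g -> bdd (fun n => f n * g n).
Proof.
by move=> [M HM] [K HK]; exists (M * K) => n; rewrite normrM ler_pM.
Qed.

Lemma bdd_norm f : bdd f -> bdd (fun n => `|f n|).
Proof. by move=> [M HM]; exists M => n; rewrite normr_id. Qed.

Lemma bddX f k : bdd f -> bdd (fun n => f n ^+ k).
Proof.
by move=> [M HM]; exists (M ^+ k) => n; rewrite normrX lerXn2r ?nnegrE // (le_trans _ (HM n)).
Qed.

Lemma bdd_bool (b : nat -> bool) : bdd (fun n => (b n)%:R).
Proof. by exists 1 => n; rewrite ger0_norm // lern1 leq_b1. Qed.

Lemma bdd_comp g (k : nat -> nat) : bdd g -> bdd (fun n => g (k n)).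
Proof. by move=> [M HM]; exists M. Qed.

Lemma bdd_sum (I : Type) (r : seq I) (P : pred I) (F : I -> nat -> R) :
  (forall i, bdd (F i)) -> bdd (fun n => \sum_(i <- r | P i) F i n).
Proof.
move=> H; elim: r => [|i r [M HM]].
  by exists 0 => n; rewrite big_nil normr0.
have [K HK] := H i; exists (K + M) => n; rewrite big_cons; case: ifP => _.
  by rewrite (le_trans (ler_normD _ _)) ?lerD.
by rewrite (le_trans (HM n)) // lerDr (le_trans _ (HK 0%N)).
Qed.

Lemma bdd_prod (I : Type) (r : seq I) (P : pred I) (F : I -> nat -> R) :
  (forall i, bdd (F i)) -> bdd (fun n => \prod_(i <- r | P i) F i n).
Proof.
move=> H; elim: r => [|i r IH].
  by exists 1 => n; rewrite big_nil normr1.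
have [K HK] := bddM (H i) IH; have [M HM] := IH.
exists (K + M) => n; rewrite big_cons; case: ifP => _.
  by rewrite (le_trans (HK n)) // lerDl (le_trans _ (HM 0%N)).
by rewrite (le_trans (HM n)) // lerDr (le_trans _ (HK 0%N)).
Qed.

Lemma bdd_moebius (k : nat -> nat) : bdd (fun n => (moebius (k n))%:~R).
Proof.
exists 1 => n; rewrite /moebius; case: ifP => _; last by rewrite normr0.
by rewrite rmorphXn /= rmorphN1 normrX normrN1 expr1n.
Qed.

Lemma avg_norm_le g M N : (forall n, `|g n| <= M) -> `|avg g N| <= M.
Proof.
move=> HM; case: N => [|N].
  by rewrite /avg invr0 mul0r normr0 (le_trans _ (HM 0%N)).
rewrite /avg normrM (ger0_norm (_ : 0 <= N.+1%:R^-1)) ?invr_ge0 //.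
rewrite mulrC ler_pdivrMr ?ltr0n // (le_trans (ler_norm_sum _ _ _)) //.
rewrite (le_trans (ler_sum _ (fun i _ => HM i))) //.
by rewrite sumr_const_nat subn1 /= mulr_natr.
Qed.

Lemma big_dvdn (F : nat -> R) p N : (0 < p)%N ->
  \sum_(1 <= n < N.+1) (p %| n)%N%:R * F n = \sum_(1 <= k < (N %/ p).+1) F (p * k)%N.
Proof.
move=> p0; have -> : \sum_(1 <= n < N.+1) (p %| n)%N%:R * F n =
    \sum_(1 <= n < N.+1 | (p %| n)%N) F n.
  rewrite [RHS]big_mkcond /=; apply: eq_bigr => n _.
  by case: (p %| n)%N; rewrite ?mul1r ?mul0r.
rewrite -big_filter -(big_map (fun k => p * k)%N predT); apply: perm_big.
apply: uniq_perm.
- by rewrite filter_uniq // iota_uniq.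
- rewrite map_inj_uniq ?iota_uniq // => x y /eqP.
  by rewrite eqn_pmul2l // => /eqP.
- move=> n; rewrite mem_filter mem_index_iota; apply/idP/idP.
    case/andP => /dvdnP[k ->]; rewrite ltnS => /andP[k0 kN].
    rewrite mulnC map_f // mem_index_iota ltnS leq_divRL // kN andbT.
    by move: k0; rewrite muln_gt0 => /andP[].
  case/mapP => k; rewrite mem_index_iota ltnS leq_divRL // => /andP[k0 kN] ->.
  by rewrite dvdn_mulr //= muln_gt0 p0 k0 ltnS mulnC.
Qed.

End LogMean.
#[local] Hint Resolve bdd_cst bddD bddN bddM bdd_norm bddX bdd_bool bdd_sum
  bdd_prod bdd_moebius : core.

Section LogMeanTheory.
Context {R : realType} (E : (nat -> R) -> R) (HE : logmean E).
Implicit Types (f g : nat -> R) (c e : R) (N n : nat).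

Lemma eq_lm f g : f =1 g -> E f = E g.
Proof. by move=> /funext ->. Qed.

Lemma lmN f : bdd f -> E (fun n => - f n) = - E f.
Proof.
move=> bf; rewrite -mulN1r -lmZ //; apply: eq_lm => n; by rewrite mulN1r.
Qed.

Lemma lmB f g : bdd f -> bdd g -> E (fun n => f n - g n) = E f - E g.
Proof. by move=> bf bg; rewrite lmD ?lmN //; exact: bddN. Qed.

Lemma lm_le_eps g c : bdd g ->
  (forall e, 0 < e -> exists N0, forall N, (N0 <= N)%N -> lavg g N <= c + e) ->
  E g <= c.
Proof.
move=> bg H; apply/ler_addgt0Pr => e e0; have [N0 HN] := H _ e0.
exact: (lm_le HE bg HN).
Qed.

Lemma lm_cst c : E (fun=> c) = c.
Proof.
have L k N : (0 < N)%N -> lavg (fun=> k) N = k.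
  move=> N0; rewrite /lavg -mulr_sumr -/(harm N) mulrCA mulVf ?mulr1 //.
  by rewrite gt_eqF // harm_gt0.
have U k : E (fun=> k) <= k.
  by apply: (lm_le HE (N0 := 1)) => // N /L ->.
apply/eqP; rewrite eq_le U /=.
by rewrite -lerN2 -(lmN (bdd_cst _)) U.
Qed.

(** Bounded partial sums are swamped by the divergent normaliser [harm N]. Invariance of [E] under
    shifts, dilations and Cesaro averaging all reduces to such a bound. *)
Lemma lm_small g (C : R) : bdd g ->
  (forall N, `|\sum_(1 <= n < N.+1) g n / n%:R| <= C) -> E g = 0.
Proof.
have K h : bdd h -> (forall N, `|\sum_(1 <= n < N.+1) h n / n%:R| <= C) ->
    E h <= 0.
  move=> bh H; apply: lm_le_eps => // e e0.
  have [N0 HN0] := harm_unbounded (C / e); exists N0.+1 => N lN.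
  have hN : 0 < @harm R N by apply: harm_gt0; exact: leq_trans lN.
  rewrite add0r /lavg ler_pdivrMl //.
  rewrite (le_trans (ler_norm _)) // (le_trans (H N)) //.
  by rewrite -ler_pdivrMr // HN0 // ltnW.
move=> bg H; apply/eqP; rewrite eq_le K //= -oppr_le0 -lmN // K //; first exact: bddN.
move=> N; under eq_bigr do rewrite mulNr; by rewrite sumrN normrN.
Qed.

Lemma lm_small_diff f g (C : R) : bdd f -> bdd g ->
  (forall N, `|\sum_(1 <= n < N.+1) f n / n%:R - \sum_(1 <= n < N.+1) g n / n%:R| <= C) ->
  E f = E g.
Proof.
move=> bf bg H; apply/eqP; rewrite -subr_eq0 -lmB //; apply/eqP.
apply: (@lm_small _ C); first exact: bddD _ (bddN _).
move=> N; under eq_bigr do rewrite mulrBl; by rewrite sumrB.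
Qed.

Lemma lm_mono0 f g : bdd f -> bdd g -> (forall n, (0 < n)%N -> f n <= g n) ->
  E f <= E g.
Proof.
move=> bf bg H; rewrite -subr_le0 -lmB //.
apply: (@lm_le _ _ HE _ _ 0); first exact: bddD _ (bddN _).
move=> N _; rewrite /lavg mulr_ge0_le0 ?invr_ge0 ?harm_ge0 //.
rewrite big_nat; apply: sumr_le0 => i /andP[i0 _].
by rewrite mulr_le0_ge0 ?invr_ge0 // subr_le0 H.
Qed.

Lemma lm_mono f g : bdd f -> bdd g -> (forall n, f n <= g n) -> E f <= E g.
Proof. by move=> bf bg H; apply: lm_mono0. Qed.

Lemma lm_ge0 f : bdd f -> (forall n, 0 <= f n) -> 0 <= E f.
Proof. by move=> bf H; rewrite -[leLHS](lm_cst 0); exact: lm_mono. Qed.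

Lemma lm_norm f : bdd f -> `|E f| <= E (fun n => `|f n|).
Proof.
move=> bf; have bn := bdd_norm bf; rewrite ler_norml; apply/andP; split.
  rewrite -lmN //; apply: lm_mono => // [|n]; first exact: bddN.
  by rewrite lerNl -normrN ler_norm.
by apply: lm_mono => // n; rewrite ler_norm.
Qed.

Lemma lm_le_norm f c : bdd f -> (forall n, `|f n| <= c) -> `|E f| <= c.
Proof.
move=> bf H; rewrite (le_trans (lm_norm bf)) // -[leRHS]lm_cst.
by apply: lm_mono => //; exact: bdd_norm.
Qed.

Lemma lm_sum (I : Type) (r : seq I) (P : pred I) (F : I -> nat -> R) :
  (forall i, bdd (F i)) ->
  E (fun n => \sum_(i <- r | P i) F i n) = \sum_(i <- r | P i) E (F i).
Proof.
move=> H; elim: r => [|i r IH].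
  by rewrite big_nil -[RHS](lm_cst 0); apply: eq_lm => n; rewrite big_nil.
rewrite big_cons -IH; case: ifP => Pi.
  rewrite -lmD //; last exact: bdd_sum.
  by apply: eq_lm => n; rewrite big_cons Pi.
by apply: eq_lm => n; rewrite big_cons Pi.
Qed.

Lemma lm_eventually f g N0 : bdd f -> bdd g ->
  (forall n, (N0 <= n)%N -> f n = g n) -> E f = E g.
Proof.
move=> bf bg H.
apply: (@lm_small_diff f g (\sum_(1 <= n < N0.+1) `|(f n - g n) / n%:R|)) => // N.
rewrite -sumrB (le_trans (ler_norm_sum _ _ _)) //.
rewrite (@le_trans _ _ (\sum_(1 <= n < (maxn N N0).+1) `|(f n - g n) / n%:R|)) //.
  rewrite (@big_cat_nat _ _ _ N.+1 1 (maxn N N0).+1) //= ?ltnS ?leq_maxl //.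
  rewrite (eq_bigr (fun n => `|(f n - g n) / n%:R|)) => [|n _]; last by rewrite mulrBl.
  by rewrite lerDl sumr_ge0.
rewrite (@big_cat_nat _ _ _ N0.+1 1 (maxn N N0).+1) //= ?ltnS ?leq_maxr //.
rewrite [X in _ + X]big_nat [X in _ + X]big1 ?addr0 // => i /andP[i0 _].
by rewrite H ?subrr ?mul0r ?normr0 // ltnW.
Qed.

(** Replacing the weight 1 / n by 1 / (n + 1) costs a telescoping sum of size at most M; the
    remaining difference telescopes to two boundary terms, each at most M. *)
Lemma lm_shift1 g : bdd g -> E (fun n => g n.+1) = E g.
Proof.
move=> bg; have [M HM] := bg.
have M0 : 0 <= M by rewrite (le_trans _ (HM 0%N)).
apply: (@lm_small_diff _ _ (M + M + M)) => //; first exact: bdd_comp.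
move=> N; pose a n : R := g n / n%:R.
have -> : \sum_(1 <= n < N.+1) g n.+1 / n%:R =
    \sum_(1 <= n < N.+1) a n.+1 + \sum_(1 <= n < N.+1) g n.+1 * (n%:R^-1 - n.+1%:R^-1).
  rewrite -big_split /=; apply: eq_bigr => n _; rewrite /a; ring.
rewrite addrAC -sumrB (GRing.telescope_sumr_eq a) // (le_trans (ler_normD _ _)) // lerD //.
  have Ha n : (0 < n)%N -> `|a n| <= M.
    move=> n0; rewrite /a normrM (ger0_norm (_ : 0 <= n%:R^-1)) ?invr_ge0 //.
    by rewrite ler_pdivrMr ?ltr0n // (le_trans (HM n)) // ler_peMr // ler1n.
  by rewrite (le_trans (ler_normB _ _)) // lerD // Ha.
rewrite (le_trans (ler_norm_sum _ _ _)) //.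
rewrite (@le_trans _ _ (\sum_(1 <= n < N.+1) (M * - n.+1%:R^-1 - M * - n%:R^-1))) //.
  rewrite big_nat [leRHS]big_nat; apply: ler_sum => n /andP[n0 _].
  have d0 : 0 <= n%:R^-1 - n.+1%:R^-1 :> R.
    by rewrite subr_ge0 lef_pV2 ?posrE ?ltr0n // ler_nat.
  rewrite normrM (ger0_norm d0) -mulrBr opprK [- _ + _]addrC ler_wpM2r //.
rewrite (GRing.telescope_sumr_eq (fun n => M * - n%:R^-1)) // mulrN mulrN invr1 mulr1 opprK.
by rewrite addrC gerDl oppr_le0 mulr_ge0 ?invr_ge0.
Qed.

Lemma lm_shift g k : bdd g -> E (fun n => g (n + k)%N) = E g.
Proof.
move=> bg; elim: k => [|k IH]; first by apply: eq_lm => n; rewrite addn0.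
rewrite -IH -[RHS]lm_shift1; last exact: (bdd_comp (fun n => n + k)%N).
by apply: eq_lm => n; rewrite addSnnS.
Qed.

(* Partial summation: the only link between the Cesaro averages of the statement
   and logarithmic means. *)
Lemma lm_avg g : bdd g -> E (avg g) = E g.
Proof.
move=> bg; have [M HM] := bg.
have M0 : 0 <= M by rewrite (le_trans _ (HM 0%N)).
have HA n : `|avg g n| <= M by exact: avg_norm_le.
have bA : bdd (avg g) by exists M.
symmetry; apply: (@lm_small_diff _ _ (M + M)) => // N.
rewrite -sumrB.
pose S n := \sum_(1 <= k < n.+1) g k.
have SE n : avg g n = n%:R^-1 * S n by [].
(* The first sum telescopes to S N / (N + 1), the second is dominated by a telescoping sum, and the
   third vanishes termwise because S n is n times [avg g n]. *)
have -> : \sum_(1 <= n < N.+1) (g n / n%:R - avg g n / n%:R) =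
    \sum_(1 <= n < N.+1) (S n / n.+1%:R - S n.-1 / n%:R)
    - \sum_(1 <= n < N.+1) avg g n * (n%:R^-1 - n.+1%:R^-1)
    + \sum_(1 <= n < N.+1) (S n / n%:R - S n / n.+1%:R - avg g n / n%:R + avg g n * (n%:R^-1 - n.+1%:R^-1)).
  rewrite -sumrB -big_split /= big_nat [RHS]big_nat.
  apply: eq_bigr => -[//|n] _ /=.
  have -> : S n.+1 = S n + g n.+1 by rewrite /S big_nat_recr.
  ring.
rewrite [X in _ + X]big_nat [X in _ + X]big1 ?addr0; last first.
  move=> [//|n] _; rewrite SE.
  have n1 : n.+1%:R != 0 :> R by rewrite pnatr_eq0.
  have n2 : n.+1%:R + 1 != 0 :> R by rewrite natr1 pnatr_eq0.
  rewrite -(natr1 n.+1); move: (S n.+1) n1 n2; move: (n.+1%:R) => x y x0 x1.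
  by field; rewrite x0 x1.
rewrite (le_trans (ler_normB _ _)) // lerD //.
  rewrite (GRing.telescope_sumr_eq (fun n => S n.-1 / n%:R)) //=.
  rewrite {2}/S big_geq // mul0r subr0 normrM (ger0_norm (_ : 0 <= N.+1%:R^-1)) ?invr_ge0 //.
  rewrite ler_pdivrMr ?ltr0n // (le_trans (ler_norm_sum _ _ _)) //.
  rewrite (le_trans (ler_sum _ (fun i _ => HM i))) //.
  by rewrite sumr_const_nat subn1 /= -[leLHS]mulr_natr ler_wpM2l // ler_nat.
rewrite (le_trans (ler_norm_sum _ _ _)) //.
rewrite (@le_trans _ _ (\sum_(1 <= n < N.+1) (M * - n.+1%:R^-1 - M * - n%:R^-1))) //.
  rewrite big_nat [leRHS]big_nat; apply: ler_sum => n /andP[n0 _].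
  have d0 : 0 <= n%:R^-1 - n.+1%:R^-1 :> R.
    by rewrite subr_ge0 lef_pV2 ?posrE ?ltr0n // ler_nat.
  by rewrite normrM (ger0_norm d0) -mulrBr opprK [- _ + _]addrC ler_wpM2r.
rewrite (GRing.telescope_sumr_eq (fun n => M * - n%:R^-1)) // mulrN mulrN invr1 mulr1 opprK.
by rewrite addrC gerDl oppr_le0 mulr_ge0 ?invr_ge0.
Qed.

Lemma bdd_avg g : bdd g -> bdd (avg g).
Proof. by move=> [M HM]; exists M => N; exact: avg_norm_le. Qed.

Lemma lm_cvg0 g : bdd g -> g @ \oo --> (0 : R) -> E g = 0.
Proof.
move=> bg /cvgrPdist_le H; apply/eqP; rewrite -normr_eq0 eq_le normr_ge0 andbT.
apply/ler_addgt0Pr => e e0; rewrite add0r.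
have [N0 _ HN] := H _ e0.
pose h n := if (N0 <= n)%N then g n else 0.
have bh : bdd h.
  by have [M HM] := bg; exists M => n; rewrite /h; case: ifP => // _;
     rewrite normr0 (le_trans _ (HM 0%N)).
rewrite (@lm_eventually g h N0) //; last by move=> n ln; rewrite /h ln.
apply: lm_le_norm => // n; rewrite /h; case: ifP => [/HN /=|_].
  by rewrite sub0r normrN.
by rewrite normr0 ltW.
Qed.

Lemma lm_avg0 g : bdd g -> avg g @ \oo --> (0 : R) -> E g = 0.
Proof. by move=> bg H; rewrite -lm_avg // lm_cvg0 //; exact: bdd_avg. Qed.

Lemma lm_gtP g c N0 : bdd g -> c < E g -> exists2 N, (N0 <= N)%N & c < lavg g N.
Proof.
move=> bg cE; apply: contrapT => H; move: cE; rewrite ltNge => /negP; apply.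
apply: (@lm_le _ _ HE _ _ N0) => // N lN; rewrite leNgt; apply/negP => HN.
by apply: H; exists N.
Qed.

(** On n = p k the weight 1 / n releases the factor 1 / p. The sum over k stops at N / p instead of
    N, but the missing terms have p k > N: at most N terms of size at most M / N, a bounded
    error. *)
Lemma lm_dil p g : (0 < p)%N -> bdd g ->
  E (fun n => (p %| n)%:R * g (n %/ p)%N) = p%:R^-1 * E g.
Proof.
move=> p0 bg; have [M HM] := bg.
have M0 : 0 <= M by rewrite (le_trans _ (HM 0%N)).
have b1 : bdd (fun n => (p %| n)%:R * g (n %/ p)%N).
  by apply: bddM => //; exact: bdd_comp.
rewrite -lmZ //; apply: (@lm_small_diff _ _ M) => //; first exact: bddM.
move=> N; set K := (N %/ p)%N.
have -> : \sum_(1 <= n < N.+1) (p %| n)%:R * g (n %/ p)%N / n%:R =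
    \sum_(1 <= n < K.+1) p%:R^-1 * g n / n%:R.
  under eq_bigr do rewrite -mulrA.
  rewrite big_dvdn //; apply: eq_bigr => n _.
  by rewrite mulKn // natrM invfM mulrCA mulrA.
rewrite distrC (@big_cat_nat _ _ _ K.+1 1 N.+1) //=; last by rewrite ltnS leq_div.
rewrite addrAC subrr add0r (le_trans (ler_norm_sum _ _ _)) //.
case: N @K => [|N] K; first by rewrite /K div0n big_geq.
apply: (@le_trans _ _ (\sum_(K.+1 <= n < N.+2) M / N.+1%:R)).
  rewrite big_nat [leRHS]big_nat; apply: ler_sum => n /andP[Kn _].
  have n0 : (0 < n)%N by exact: leq_trans Kn.
  have -> : p%:R^-1 * g n / n%:R = g n * (p * n)%:R^-1.
    by rewrite natrM invfM mulrA [_ * g n]mulrC.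
  rewrite normrM (ger0_norm (_ : 0 <= (p * n)%:R^-1)) ?invr_ge0 //.
  rewrite ler_pM ?invr_ge0 // lef_pV2 ?posrE ?ltr0n ?muln_gt0 ?p0 // ler_nat.
  by rewrite mulnC ltnW // -ltn_divLR.
rewrite sumr_const_nat -[leLHS]mulr_natr -mulrA -[leRHS]mulr1 ler_wpM2l //.
by rewrite mulrC ler_pdivrMr ?ltr0n // mul1r ler_nat subSS leq_subr.
Qed.

End LogMeanTheory.

(** * Existence of logarithmic means, as ultrafilter limits *)

Lemma bounded_ultralimit (R : realType) (F : set_system nat) (u : nat -> R) (M : R) :
  UltraFilter F -> (forall n, `|u n| <= M) -> exists l : R, u @ F --> l.
Proof.
move=> UF HM; have PF := @ultra_proper _ _ UF.
have := @segment_compact R (- M) M => /(_ (u @ F) _)[].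
  by apply: (@filterE _ F) => n /=; rewrite in_itv /= -ler_norml; exact: HM.
move=> l [_ Hl]; exists l; apply/cvgrPdist_lt => e e0.
have [//|H] := in_ultra_setVsetC [set n | `|l - u n| < e] UF.
exfalso; have [] := Hl [set x | ~ (`|l - x| < e)] (ball l e) _ _.
- exact: H.
- exact: nbhsx_ballx.
by move=> x [/= h1 h2].
Qed.

Lemma lavg_le (R : realType) (g : nat -> R) M : (forall n, `|g n| <= M) ->
  forall N, `|lavg g N| <= M.
Proof.
move=> HM; have M0 : 0 <= M by rewrite (le_trans _ (HM 0%N)).
case=> [|N]; first by rewrite /lavg big_geq // mulr0 normr0.
have h0 := @harm_gt0 R N.+1 isT.
rewrite /lavg normrM (ger0_norm (_ : 0 <= (harm _)^-1)) ?invr_ge0 ?harm_ge0 //.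
rewrite mulrC ler_pdivrMr // (le_trans (ler_norm_sum _ _ _)) //.
rewrite /harm mulr_sumr; apply: ler_sum => n _.
by rewrite normrM (ger0_norm (_ : 0 <= n%:R^-1)) ?invr_ge0 // ler_wpM2r ?invr_ge0.
Qed.

(** The ultrafilter refines the cofinite filter restricted to [A], so a lower bound that holds only
    along [A] survives in the limit. This turns a failure at infinitely many N into a statement
    about one mean. *)
Lemma logmean_along (R : realType) (A : set nat) :
  (forall N0, exists2 N, (N0 <= N)%N & A N) ->
  exists2 E : (nat -> R) -> R, logmean E &
    forall g c, bdd g -> (forall N, A N -> c <= lavg g N) -> c <= E g.
Proof.
move=> HA; have PA : ProperFilter (within A \oo).
  apply: Build_ProperFilter_ex => P [N0 _ H].
  by have [N NN AN] := HA N0; exists N; exact: H NN AN.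
have [F [UF FO]] := ultraFilterLemma PA.
have PF := @ultra_proper _ _ UF.
have cvgE (g : nat -> R) : bdd g -> lavg g @ F --> lim (lavg g @ F).
  move=> [M /lavg_le HM]; have [l Hl] := bounded_ultralimit UF HM.
  by apply/cvg_ex; exists l.
exists (fun g => lim (lavg g @ F)); first split.
- move=> f g bf bg.
  have -> : lavg (fun n => f n + g n) = (fun N => lavg f N + lavg g N).
    apply/funext => N; rewrite /lavg -mulrDr -big_split /=; congr (_ * _).
    by apply: eq_bigr => n _; rewrite mulrDl.
  by apply: cvg_lim => //; apply: cvgD; exact: cvgE.
- move=> c f bf.
  have -> : lavg (fun n => c * f n) = (fun N => c * lavg f N).
    apply/funext => N; rewrite /lavg [RHS]mulrCA [c * _]mulr_sumr; congr (_ * _).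
    by apply: eq_bigr => n _; rewrite mulrA.
  by apply: cvg_lim => //; apply: cvgMr; exact: cvgE.
- move=> g c N0 bg H; apply: (cvgr_to_le (cvgE g bg)).
  by apply: FO; exists N0 => //= N HN _; exact: H.
move=> g c bg H; apply: (cvgr_to_ge (cvgE g bg)).
by apply: FO; exists 0%N => //= N _; exact: H.
Qed.

(** * Residue classes under a logarithmic mean *)

Section Residues.
Context {R : realType} (E : (nat -> R) -> R) (HE : logmean E).

Lemma lm_residue m r (g : nat -> R) : (r < m)%N -> bdd g ->
  E (fun n => (n %% m == r)%N%:R * g n) = E (fun n => (m %| n)%:R * g (n + r)%N).
Proof.
move=> rm bg; rewrite -(lm_shift HE r); last exact: bddM.
apply: eq_lm => n; congr ((nat_of_bool _)%:R * _).
have := eqn_modDr r n 0 m; rewrite add0n (modn_small rm) mod0n => ->; by [].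
Qed.

(** Each residue class modulo m, shifted back to the multiples of m, contributes E G / m by
    [lm_dil]. *)
Lemma lm_divn m (G : nat -> R) : (0 < m)%N -> bdd G ->
  E (fun n => G (n %/ m)%N) = E G.
Proof.
move=> m0 bG; have bGm : bdd (fun n => G (n %/ m)%N) by exact: bdd_comp.
have -> : E (fun n => G (n %/ m)%N) =
    E (fun n => \sum_(r < m) (n %% m == r)%N%:R * G (n %/ m)%N).
  apply: eq_lm => n; rewrite (bigD1 (Ordinal (ltn_pmod n m0))) //= eqxx mul1r.
  rewrite big1 ?addr0 // => i /eqP ne; case: eqP; rewrite ?mul0r // => H.
  by case: ne; apply: val_inj.
rewrite (lm_sum HE); last by move=> i; exact: bddM.
rewrite (eq_bigr (fun=> m%:R^-1 * E G)) => [|r _].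
  by rewrite sumr_const card_ord -[LHS]mulr_natl mulrA mulfV ?mul1r // pnatr_eq0 -lt0n.
rewrite lm_residue // -(lm_dil HE) //; apply: eq_lm => n.
case: (boolP (m %| n)%N) => [/dvdnP[k ->]|_]; last by rewrite !mul0r.
by rewrite divnMDl // divn_small // addn0 mulnK.
Qed.

Lemma lm_progressions m (g : nat -> R) : (0 < m)%N -> bdd g ->
  \sum_(r < m) E (fun n => g (n * m + r)%N) = m%:R * E g.
Proof.
move=> m0 bg.
have bgk (k : nat -> nat) : bdd (fun n => g (k n)) by exact: bdd_comp.
rewrite (eq_bigr (fun r : 'I_m => m%:R * E (fun n => (n %% m == r)%N%:R * g n))) => [|r _].
  rewrite -mulr_sumr -(lm_sum HE); last by move=> i; exact: bddM.
  congr (_ * _); apply: eq_lm => n.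
  rewrite (bigD1 (Ordinal (ltn_pmod n m0))) //= eqxx mul1r big1 ?addr0 // => i /eqP ne.
  by case: eqP; rewrite ?mul0r // => H; case: ne; apply: val_inj.
rewrite lm_residue //; apply: (@mulfI _ m%:R^-1).
  by rewrite invr_eq0 pnatr_eq0 -lt0n.
rewrite -(lm_dil HE) // mulrA mulVf ?mul1r ?pnatr_eq0 -?lt0n //.
apply: eq_lm => n; case: (boolP (m %| n)%N) => [/dvdnP[k ->]|_]; last by rewrite !mul0r.
by rewrite mulnK.
Qed.

End Residues.

(** * Entropy of finite-valued sequences *)

Lemma ler_ln_pos (R : realType) (x y : R) : 0 < x -> x <= y -> ln x <= ln y.
Proof.
move=> x0 xy; have y0 : 0 < y by exact: lt_le_trans xy.
by rewrite ler_ln.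
Qed.

(** The termwise form of Gibbs' inequality, from ln (1 + x) <= x. The implication rules out q = 0 <
    p, where the junk value of [ln] at 0 would break the bound for small p. *)
Lemma mul_ln_le (R : realType) (p q : R) : 0 <= p -> 0 <= q -> (q = 0 -> p = 0) ->
  p * (ln q - ln p) <= q - p.
Proof.
move=> p0 q0 H; have [->|pN] := eqVneq p 0; first by rewrite mul0r subr0.
have p0' : 0 < p by rewrite lt_neqAle eq_sym pN.
have q0' : 0 < q.
  by rewrite lt_neqAle q0 andbT eq_sym; apply: contra_neq pN.
rewrite -ln_div // mulrC -ler_pdivlMr //.
have -> : (q - p) / p = q / p - 1 by rewrite mulrBl divff.
rewrite -{1}[q / p](subrK 1) addrC le_ln1Dx //.
by rewrite ltrBrDl subrr divr_gt0.
Qed.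

Section Entropy.
Context {R : realType} (E : (nat -> R) -> R) (HE : logmean E).

Definition law (T : finType) (xi : nat -> T) (a : T) : R := E (fun n => (xi n == a)%:R).
Definition ent (T : finType) (xi : nat -> T) : R := - \sum_a law xi a * ln (law xi a).

Lemma law_ge0 (T : finType) (xi : nat -> T) a : 0 <= law xi a.
Proof. exact: (lm_ge0 HE). Qed.

Lemma sum_law (T : finType) (xi : nat -> T) : \sum_a law xi a = 1.
Proof.
rewrite /law -(lm_sum HE) //.
rewrite -[RHS](lm_cst HE); apply: eq_lm => n.
rewrite (bigD1 (xi n)) //= eqxx big1 ?addr0 // => a.
by rewrite eq_sym => /negbTE ->.
Qed.

Lemma law_le1 (T : finType) (xi : nat -> T) a : law xi a <= 1.
Proof.
rewrite -(sum_law xi) (bigD1 a) //= lerDl; apply: sumr_ge0 => b _; exact: law_ge0.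
Qed.

Lemma law_fst (T U : finType) (xi : nat -> T) (eta : nat -> U) a :
  law xi a = \sum_b law (fun n => (xi n, eta n)) (a, b).
Proof.
rewrite /law -(lm_sum HE) //.
apply: eq_lm => n.
rewrite (bigD1 (eta n)) //= xpair_eqE eqxx andbT big1 ?addr0 // => b.
by rewrite xpair_eqE eq_sym => /negbTE ->; rewrite andbF.
Qed.

Lemma law_snd (T U : finType) (xi : nat -> T) (eta : nat -> U) b :
  law eta b = \sum_a law (fun n => (xi n, eta n)) (a, b).
Proof.
rewrite (law_fst eta xi b); apply: eq_bigr => a _.
by apply: eq_lm => n; rewrite !xpair_eqE andbC.
Qed.

Lemma law_le (T U : finType) (xi : nat -> T) (eta : nat -> U) a b :
  (forall n, eta n = b -> xi n = a) -> law eta b <= law xi a.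
Proof.
move=> H; apply: (lm_mono HE); try exact: bdd_bool.
move=> n; case: eqP => [/H ->|_]; by rewrite ?eqxx.
Qed.

Lemma ent_fst (T U : finType) (xi : nat -> T) (eta : nat -> U) :
  ent xi = - \sum_a \sum_b law (fun n => (xi n, eta n)) (a, b) * ln (law xi a).
Proof.
rewrite /ent; congr (- _); apply: eq_bigr => a _.
by rewrite {1}(law_fst xi eta) mulr_suml.
Qed.

Lemma ent_snd (T U : finType) (xi : nat -> T) (eta : nat -> U) :
  ent eta = - \sum_a \sum_b law (fun n => (xi n, eta n)) (a, b) * ln (law eta b).
Proof.
rewrite exchange_big /ent /=; congr (- _); apply: eq_bigr => a _.
by rewrite {1}(law_snd xi eta) mulr_suml.
Qed.

(** Dependence is expressed by equality of values, so no factor map has to be built. A pair (a, b)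
    of positive law occurs at some n, hence eta = b forces xi = a, and the logarithms compare pair
    by pair. *)
Lemma ent_det (T U : finType) (xi : nat -> T) (eta : nat -> U) :
  (forall n n', eta n = eta n' -> xi n = xi n') -> ent xi <= ent eta.
Proof.
move=> H; rewrite (ent_fst xi eta) (ent_snd xi eta) lerN2.
apply: ler_sum => a _; apply: ler_sum => b _.
set p := law _ _; have p0 : 0 <= p := law_ge0 _ _.
have [->|pN] := eqVneq p 0; first by rewrite !mul0r.
have [n] : exists n, (xi n, eta n) = (a, b).
  apply: contrapT => /forallNP Hn; case/eqP: pN.
  rewrite /p /law -[RHS](lm_cst HE); apply: eq_lm => n.
  by case: eqP => // /Hn.
case=> xa eb; apply: ler_wpM2l => //; apply: ler_ln_pos.
  rewrite (lt_le_trans (_ : 0 < p)) //; first by rewrite lt_neqAle eq_sym pN.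
  by apply: law_le => m [].
by apply: law_le => m; rewrite -eb => /H ->.
Qed.

Lemma ent_eq (T U : finType) (xi : nat -> T) (eta : nat -> U) :
  (forall n n', eta n = eta n' <-> xi n = xi n') -> ent xi = ent eta.
Proof.
by move=> H; apply/eqP; rewrite eq_le !ent_det // => n n' /H.
Qed.

Lemma ent_ge0 (T : finType) (xi : nat -> T) : 0 <= ent xi.
Proof.
rewrite /ent oppr_ge0; apply: sumr_le0 => a _.
by rewrite mulr_ge0_le0 ?law_ge0 // ln_le0 // law_le1.
Qed.

Lemma ent_le_ln (T : finType) (xi : nat -> T) : ent xi <= ln #|T|%:R.
Proof.
have T0 : (0 < #|T|)%N by apply/card_gt0P; exists (xi 0%N).
have T0R : 0 < #|T|%:R :> R by rewrite ltr0n.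
have S1 : \sum_(a : T) #|T|%:R^-1 = 1 :> R.
  by rewrite sumr_const -[LHS]mulr_natl mulfV // gt_eqF.
have -> : ent xi = ln #|T|%:R + \sum_a law xi a * (ln #|T|%:R^-1 - ln (law xi a)).
  rewrite (eq_bigr (fun a => law xi a * ln #|T|%:R^-1 - law xi a * ln (law xi a))) => [|a _].
    by rewrite sumrB -mulr_suml sum_law mul1r lnV ?posrE // addrA subrr add0r.
  by rewrite mulrBr.
rewrite gerDl (le_trans (_ : _ <= \sum_a (#|T|%:R^-1 - law xi a))) //; last first.
  by rewrite sumrB S1 sum_law subrr.
apply: ler_sum => a _; apply: mul_ln_le; rewrite ?law_ge0 ?invr_ge0 //.
by move=> /eqP; rewrite invr_eq0 gt_eqF.
Qed.

(** Nonnegativity of conditional mutual information: Gibbs' inequality for the joint law against the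
    law q r / s that makes x and y independent given z. *)
Lemma ent_submod (T1 T2 T3 : finType) (x : nat -> T1) (y : nat -> T2) (z : nat -> T3) :
  ent (fun n => (x n, y n, z n)) + ent z <= ent (fun n => (x n, z n)) + ent (fun n => (y n, z n)).
Proof.
pose p a b c := law (fun n => (x n, y n, z n)) (a, b, c).
pose q a c := law (fun n => (x n, z n)) (a, c).
pose r b c := law (fun n => (y n, z n)) (b, c).
pose s c := law z c.
have p0 a b c : 0 <= p a b c by exact: law_ge0.
have q0 a c : 0 <= q a c by exact: law_ge0.
have r0 b c : 0 <= r b c by exact: law_ge0.
have s0 c : 0 <= s c by exact: law_ge0.
have pq a b c : p a b c <= q a c by apply: law_le => n [-> _ ->].
have pr a b c : p a b c <= r b c by apply: law_le => n [_ -> ->].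
have ps a b c : p a b c <= s c by apply: law_le => n [_ _ ->].
have qE a c : q a c = \sum_b p a b c.
  rewrite /q (law_fst (fun n => (x n, z n)) y); apply: eq_bigr => b _.
  by apply: eq_lm => n; rewrite !xpair_eqE andbAC.
have rE b c : r b c = \sum_a p a b c.
  rewrite /r (law_snd x (fun n => (y n, z n))); apply: eq_bigr => a _.
  by apply: eq_lm => n; rewrite !xpair_eqE andbA.
have sq c : s c = \sum_a q a c by rewrite /s (law_snd x z).
have sr c : s c = \sum_b r b c by rewrite /s (law_snd y z).
have e1 : ent (fun n => (x n, y n, z n)) = - \sum_a \sum_b \sum_c p a b c * ln (p a b c).
  rewrite /ent; congr (- _); rewrite pair_bigA /= pair_bigA /=.
  by apply: eq_bigr => -[[a b] c] _.
have e2 : ent (fun n => (x n, z n)) = - \sum_a \sum_b \sum_c p a b c * ln (q a c).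
  rewrite /ent; congr (- _); under [RHS]eq_bigr do rewrite exchange_big /=.
  rewrite pair_bigA /=; apply: eq_bigr => -[a c] _ /=.
  by rewrite -mulr_suml -qE.
have e3 : ent (fun n => (y n, z n)) = - \sum_a \sum_b \sum_c p a b c * ln (r b c).
  rewrite /ent; congr (- _); rewrite exchange_big /=.
  under [RHS]eq_bigr do rewrite exchange_big /=.
  rewrite pair_bigA /=; apply: eq_bigr => -[b c] _ /=.
  by rewrite -mulr_suml -rE.
have e4 : ent z = - \sum_a \sum_b \sum_c p a b c * ln (s c).
  rewrite /ent; congr (- _); under [RHS]eq_bigr do rewrite exchange_big /=.
  rewrite exchange_big /=; apply: eq_bigr => c _.
  under [RHS]eq_bigr do rewrite -mulr_suml -qE.
  by rewrite -mulr_suml -sq.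
have total : \sum_a \sum_b \sum_c p a b c = 1.
  rewrite -(sum_law (fun n => (x n, y n, z n))) pair_bigA /= pair_bigA /=.
  by apply: eq_bigr => -[[a b] c] _.
(* Where [s c] is 0, the convention 0^-1 = 0 gives the comparison law the right mass 0. *)
have total' : \sum_a \sum_b \sum_c q a c * r b c / s c = 1.
  rewrite -(sum_law z); under eq_bigr do rewrite exchange_big /=.
  rewrite exchange_big /=; apply: eq_bigr => c _.
  under eq_bigr => a _ do (rewrite -mulr_suml -mulr_sumr -sr).
  have [s00|sN] := eqVneq (s c) 0.
    by rewrite big1 -/(s c) s00 // => a _; rewrite invr0 mulr0.
  by under eq_bigr do rewrite mulfK //; rewrite -sq.
rewrite e1 e2 e3 e4 -!opprD lerN2 -subr_le0 -!big_split -sumrB /=.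
rewrite -[leRHS](subrr 1) -{1}total' -total -sumrB; apply: ler_sum => a _.
rewrite -!big_split -!sumrB /=; apply: ler_sum => b _.
rewrite -!big_split -!sumrB /=; apply: ler_sum => c _.
have [pz|pN] := eqVneq (p a b c) 0.
  by rewrite pz !mul0r !addr0 !subr0 mulr_ge0 ?invr_ge0 // mulr_ge0.
have pp : 0 < p a b c by rewrite lt_neqAle eq_sym pN p0.
have qp : 0 < q a c by exact: lt_le_trans (pq a b c).
have rp : 0 < r b c by exact: lt_le_trans (pr a b c).
have sp : 0 < s c by exact: lt_le_trans (ps a b c).
have qs : 0 < q a c * r b c / s c by rewrite divr_gt0 ?mulr_gt0.
have := @mul_ln_le R (p a b c) (q a c * r b c / s c) (p0 _ _ _) (ltW qs).
rewrite ln_div ?posrE ?mulr_gt0 // lnM ?posrE // => H.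
apply: le_trans (H _); last by move=> h; rewrite h ltxx in qs.
by rewrite le_eqVlt; apply/orP; left; apply/eqP; ring.
Qed.

End Entropy.

Definition word m (D : nat -> nat -> bool) (n : nat) : {ffun 'I_m -> bool} :=
  [ffun j : 'I_m => D j n].

Section EntropyMore.
Context {R : realType} (E : (nat -> R) -> R) (HE : logmean E).

Lemma ent_unit : ent E (fun=> tt) = 0.
Proof.
apply/eqP; rewrite eq_le (ent_ge0 HE) andbT.
by rewrite (le_trans (ent_le_ln HE _)) // card_unit ln1.
Qed.

Lemma ent_pair (T U : finType) (x : nat -> T) (y : nat -> U) :
  ent E (fun n => (x n, y n)) <= ent E x + ent E y.
Proof.
have := ent_submod HE x y (fun=> tt).
rewrite ent_unit addr0 (_ : ent E (fun n => (x n, y n, tt)) = ent E (fun n => (x n, y n))).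
  rewrite (_ : ent E (fun n => (x n, tt)) = ent E x).
    rewrite (_ : ent E (fun n => (y n, tt)) = ent E y) //.
    by apply: (ent_eq HE) => n n'; split=> [->|[]].
  by apply: (ent_eq HE) => n n'; split=> [->|[]].
by apply: (ent_eq HE) => n n'; split=> [[-> ->]|[-> ->]].
Qed.

Lemma ent_shift (T : finType) (x : nat -> T) k : ent E (fun n => x (n + k)%N) = ent E x.
Proof.
rewrite /ent; congr (- _); apply: eq_bigr => a _.
rewrite (_ : law E (fun n => x (n + k)%N) a = law E x a) //.
by rewrite /law (lm_shift HE k (g := fun n => (x n == a)%:R)).
Qed.

Lemma ent_word_le (T : finType) (Y : nat -> T) m (D : nat -> nat -> bool) :
  ent E (fun n => (Y n, word m D n)) <= ent E Y + \sum_(j < m) ent E (D j).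
Proof.
elim: m => [|m IH].
  rewrite big_ord0 addr0; apply: (ent_det HE) => n n' ->; congr (_, _).
  by apply/ffunP => -[].
rewrite big_ord_recr /= addrA.
apply: le_trans (_ : ent E (fun n => ((Y n, word m D n), D m n)) <= _); last first.
  by rewrite (le_trans (ent_pair _ _)) // lerD2r.
apply: (ent_det HE) => n n' [-> H1 H2]; congr (_, _).
apply/ffunP => j; rewrite !ffunE.
case: (unliftP ord_max j) => [i ->|->] //.
have := congr1 (fun f : {ffun 'I_m -> bool} => f i) H1.
by rewrite !ffunE lift_max.
Qed.

(** With s the square root of p, - p ln p = 2 s (- s ln s) and - s ln s <= 1 - s; the complementary
    event adds at most p. *)
Lemma ent_bool_le (b : nat -> bool) (p : R) : E (fun n => (b n)%:R) = p ->
  ent E b <= 2 * Num.sqrt p + p.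
Proof.
move=> Hp.
have p1 : law E b true = p by rewrite -Hp; apply: eq_lm => n; rewrite eqb_id.
have p0 : 0 <= p by rewrite -p1 (law_ge0 HE).
have pf : law E b false = 1 - p.
  have := sum_law HE b; rewrite big_bool /= p1 => <-; ring.
have ple : p <= 1 by rewrite -p1 (law_le1 HE).
rewrite /ent big_bool /= p1 pf opprD; apply: lerD.
  have [->|pN] := eqVneq p 0; first by rewrite mul0r oppr0 sqrtr0 mulr0.
  have pp : 0 < p by rewrite lt_neqAle eq_sym pN.
  set s := Num.sqrt p; have s0 : 0 < s by rewrite sqrtr_gt0.
  have ps : p = s * s by rewrite -expr2 sqr_sqrtr.
  have := @mul_ln_le R s 1 (ltW s0) ler01 (fun h => False_ind _ (elimF eqP (oner_eq0 R) h)).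
  rewrite ln1 sub0r => H.
  have -> : - (p * ln p) = 2 * (s * (s * - ln s)) by rewrite ps lnM ?posrE //; ring.
  rewrite ler_pM2l //; apply: (@le_trans _ _ (s * (1 - s))); first by rewrite ler_pM2l.
  by rewrite mulrBr mulr1 gerBl mulr_ge0 // ltW.
have := @mul_ln_le R (1 - p) 1 _ ler01 (fun h => False_ind _ (elimF eqP (oner_eq0 R) h)).
rewrite ln1 sub0r mulrN subr_ge0 => /(_ ple) /le_trans; apply.
by rewrite opprB addrC subrK.
Qed.

(* Concavity: the law of x is the mean of its laws along the residue classes. *)
Lemma ent_progressions (T : finType) (x : nat -> T) m : (0 < m)%N ->
  \sum_(r < m) ent E (fun n => x (n * m + r)%N) <= m%:R * ent E x.
Proof.
move=> m0; rewrite /ent sumrN mulrN lerN2 exchange_big /= mulr_sumr.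
apply: ler_sum => a _; set p := law E x a.
pose q (r : 'I_m) := law E (fun n => x (n * m + r)%N) a.
have q0 r : 0 <= q r by exact: law_ge0.
have Sq : \sum_r q r = m%:R * p.
  exact: (lm_progressions HE m0 (g := fun n => (x n == a)%:R)).
have -> : m%:R * (p * ln p) = \sum_r (q r * ln p - (p - q r)).
  rewrite sumrB -mulr_suml Sq sumrB Sq sumr_const card_ord -[p *+ m]mulr_natl.
  by rewrite subrr subr0 mulrA.
apply: ler_sum => r _; rewrite lerBlDr -lerBlDl -mulrBr.
apply: mul_ln_le; rewrite ?(law_ge0 HE) //.
move=> p00; apply/eqP; rewrite eq_le q0 andbT.
have : q r <= \sum_r q r by rewrite (bigD1 r) //= lerDl sumr_ge0.
by rewrite Sq p00 mulr0.
Qed.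

(** Every listed value has mass at least exp (- t) and the total mass is 1. *)
Lemma card_typical (T : finType) (x : nat -> T) (t : R) :
  #|[pred a | expR (- t) <= law E x a]|%:R <= expR t.
Proof.
have h : \sum_(a in [pred a | expR (- t) <= law E x a]) expR (- t) <= 1.
  rewrite -(sum_law HE x) [leRHS](bigID (mem [pred a | expR (- t) <= law E x a])) /=.
  rewrite -[leLHS]addr0 lerD //; last by apply: sumr_ge0 => a _; exact: law_ge0.
  by apply: ler_sum => a; rewrite inE.
move: h; rewrite sumr_const -[leLHS]mulr_natl -ler_pdivlMr ?expR_gt0 //.
by rewrite expRN invrK mul1r.
Qed.

(** Markov's inequality for the information - ln (law), whose mean is the entropy. *)
Lemma atypical_le (T : finType) (x : nat -> T) (t : R) : 0 < t ->
  E (fun n => (x n \notin [pred a | expR (- t) <= law E x a])%:R) <= ent E x / t.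
Proof.
move=> t0; set W := [pred a | _].
have -> : E (fun n => (x n \notin W)%:R) = \sum_(a | a \notin W) law E x a.
  rewrite /law -(lm_sum HE) //; apply: eq_lm => n.
  have [xW|xW] := boolP (x n \notin W).
    rewrite (bigD1 (x n)) //= eqxx big1 ?addr0 // => a /andP[_].
    by rewrite eq_sym => /negbTE ->.
  rewrite big1 // => a aW; case: eqP => // xa; by rewrite xa (negbTE aW) in xW.
rewrite ler_pdivlMr // mulr_suml /ent.
rewrite [X in _ <= - X](bigID (fun a => a \notin W)) /= opprD -[leLHS]addr0 lerD //; last first.
  rewrite oppr_ge0; apply: sumr_le0 => a _.
  by rewrite mulr_ge0_le0 ?(law_ge0 HE) // ln_le0 // (law_le1 HE).
rewrite -sumrN; apply: ler_sum => a; rewrite !inE -ltNge => ha.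
rewrite -mulrN; have [->|pN] := eqVneq (law E x a) 0; first by rewrite !mul0r.
have pp : 0 < law E x a by rewrite lt_neqAle eq_sym pN (law_ge0 HE).
rewrite ler_pM2l // lerNr -[- t]expRK; apply: ler_ln_pos => //; exact: ltW.
Qed.

End EntropyMore.

(** * Predictors from the future have low entropy *)

(* g n is a function of n mod q and of finitely many v (n + j) with j >= w.
   Residues are included because the predictors involve divisibility. *)
Definition future (V T : Type) (v : nat -> V) (w : nat) (g : nat -> T) : Prop :=
  exists M q, (0 < q)%N /\ forall n n', n = n' %[mod q] ->
    (forall j, (w <= j < M)%N -> v (n + j)%N = v (n' + j)%N) -> g n = g n'.

Section LowEntropy.
Context {R : realType} (E : (nat -> R) -> R) (HE : logmean E).

(** For p <= 1 the bound 2 sqrt p + p is at most 3 sqrt p, whence the 3. *)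
Lemma ent_bool_small (b : nat -> bool) (c : R) : 0 <= c ->
  E (fun n => (b n)%:R) <= (c / 3) ^+ 2 -> ent E b <= c.
Proof.
move=> c0 H; rewrite (le_trans (ent_bool_le HE (erefl _))) //.
set p := E _ in H *.
have p0 : 0 <= p by exact: (lm_ge0 HE).
have p1 : p <= 1.
  by rewrite -[leRHS](lm_cst HE); apply: (lm_mono HE) => // n; rewrite lern1 leq_b1.
have c3 : 0 <= c / 3 by rewrite divr_ge0.
have sp : Num.sqrt p <= c / 3.
  by rewrite -[leRHS](ger0_norm c3) -sqrtr_sqr ler_wsqrtr.
have ps : p <= Num.sqrt p.
  rewrite -{1}(sqr_sqrtr p0) expr2 -[leRHS]mul1r ler_wpM2r ?sqrtr_ge0 //.
  by rewrite -sqrtr1 ler_wsqrtr.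
lra.
Qed.

Context (V : finType) (v : nat -> V).

Definition win A n : {ffun 'I_A -> V} := [ffun j : 'I_A => v (n + j)%N].
Definition res q n : 'I_q.+1 := inord (n %% q.+1)%N.

Lemma win_eq A n n' : win A n = win A n' <->
  forall j, (j < A)%N -> v (n + j)%N = v (n' + j)%N.
Proof.
split=> [H j jA|H].
  by have := congr1 (fun f : {ffun 'I_A -> V} => f (Ordinal jA)) H; rewrite !ffunE.
by apply/ffunP => j; rewrite !ffunE H.
Qed.

Lemma res_eq q n n' : res q n = res q n' <-> n = n' %[mod q.+1].
Proof.
split=> [/(congr1 (@nat_of_ord _))|H]; last by rewrite /res H.
by rewrite /res !inordK ?ltn_pmod.
Qed.

Lemma res_shift q k n n' : res q (n + k) = res q (n' + k) <-> res q n = res q n'.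
Proof.
rewrite !res_eq; split=> /eqP; first by rewrite eqn_modDr => /eqP.
by move=> /eqP H; apply/eqP; rewrite eqn_modDr; apply/eqP.
Qed.

Let a A := ent E (win A).

Lemma ent_win_ge0 A : 0 <= a A. Proof. exact: ent_ge0. Qed.

Lemma ent_win_mono A B : (A <= B)%N -> a A <= a B.
Proof.
move=> AB; apply: (ent_det HE) => n n' /win_eq H; apply/win_eq => j jA.
exact: H (leq_trans jA AB).
Qed.

Lemma ent_win_sub A B : a (A + B)%N <= a A + a B.
Proof.
rewrite -[a B](ent_shift HE _ A) (le_trans _ (ent_pair HE _ _)) //.
apply: (ent_det HE) => n n' [/win_eq H1 /win_eq H2]; apply/win_eq => j jAB.
have [jA|Aj] := ltnP j A; first exact: H1.
have := H2 (j - A)%N; rewrite -!addnA subnKC // => -> //.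
by rewrite ltn_subLR.
Qed.

(** The Kolmogorov-Sinai entropy rate of [v] under [E]: window entropies are subadditive, so by
    Fekete's lemma this infimum is a limit. *)
Definition ent_rate : R := inf [set a A.+1 / A.+1%:R | A in setT].
Let h := ent_rate.

Lemma ent_rate_le A : h * A%:R <= a A.
Proof.
case: A => [|A]; first by rewrite mulr0 ent_win_ge0.
rewrite -ler_pdivlMr ?ltr0n //; apply: ge_inf; last by exists A.
by exists 0 => _ [B _ <-]; rewrite divr_ge0 ?ent_win_ge0.
Qed.

Lemma ent_rate_ge0 : 0 <= h.
Proof.
apply: lb_le_inf; first by exists (a 1 / 1); exists 0%N.
by move=> _ [B _ <-]; rewrite divr_ge0 ?ent_win_ge0.
Qed.

Lemma ent_win_upper (e : R) : 0 < e -> exists C, forall A, a A <= (h + e) * A%:R + C.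
Proof.
move=> e0.
have hi : has_inf [set a A.+1 / A.+1%:R | A in setT].
  split; first by exists (a 1 / 1); exists 0%N.
  by exists 0 => _ [B _ <-]; rewrite divr_ge0 ?ent_win_ge0.
have [_ [A0 _ <-] HA0] := inf_adherent e0 hi.
exists (a A0.+1) => A.
rewrite (divn_eq A A0.+1).
have step k : a (k * A0.+1)%N <= k%:R * a A0.+1.
  elim: k => [|k IH].
    by rewrite mul0n mul0r /a (le_trans (ent_le_ln HE _)) // card_ffun card_ord expn0 ln1.
  rewrite mulSn -[k.+1%:R]natr1 mulrDl mul1r addrC.
  by rewrite (le_trans (ent_win_sub _ _)) // lerD2l.
rewrite (le_trans (ent_win_sub _ _)) // lerD //; last first.
  by apply: ent_win_mono; rewrite ltnW // ltn_pmod.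
rewrite (le_trans (step _)) //.
rewrite natrD mulrDr -[leLHS]addr0 lerD //; last first.
  by rewrite mulr_ge0 // addr_ge0 ?ent_rate_ge0 // ltW.
rewrite natrM mulrCA ler_wpM2l //.
by rewrite -ler_pdivrMr ?ltr0n // ltW.
Qed.

Let G q m := ent E (fun n => (win m n, res q n)).

Lemma ent_shifted_win q A M :
  ent E (fun n => (win M (n + A)%N, res q n)) = G q M.
Proof.
rewrite /G -[RHS](ent_shift HE _ A); apply: (ent_eq HE) => n n'.
split=> [[H1 /res_shift H2]|[H1 H2]]; first by rewrite H1 H2.
by rewrite H1; congr pair; apply/res_shift.
Qed.

Lemma ent_joined_win q A M :
  ent E (fun n => (win A n, win M (n + A)%N, res q n)) = G q (A + M).
Proof.
apply: (ent_eq HE) => n n'; split=> [[/win_eq H ->]|[/win_eq H1 /win_eq H2 ->]].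
  congr (_, _, _); apply/win_eq => j jA; first by apply: H; rewrite ltn_addr.
  by rewrite -!addnA; apply: H; rewrite ltn_add2l.
congr pair; apply/win_eq => j jAB.
have [jA|Aj] := ltnP j A; first exact: H1.
have := H2 (j - A)%N; rewrite -!addnA subnKC // => -> //.
by rewrite ltn_subLR.
Qed.

(** Submodularity for the windows on either side of a middle window of length M: the more of the
    right is known, the less new information an extension to the left brings. *)
Lemma ent_incr_anti q A M B : G q (A + (M + B)) + G q M <= G q (A + M) + G q (M + B).
Proof.
have := ent_submod HE (win A) (fun n => win B (n + A + M)%N)
   (fun n => (win M (n + A)%N, res q n)).
rewrite ent_shifted_win.
rewrite (_ : ent E (fun n => (win A n, (win M (n + A)%N, res q n))) = G q (A + M)); last first.
  rewrite -ent_joined_win; apply: (ent_eq HE) => n n'.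
  by split=> [[-> -> ->]|[-> -> ->]].
rewrite (_ : ent E (fun n => (win B (n + A + M)%N, (win M (n + A)%N, res q n))) = G q (M + B)).
  rewrite (_ : ent E (fun n => (win A n, win B (n + A + M)%N, (win M (n + A)%N, res q n))) = G q (A + (M + B))) //.
  rewrite -ent_joined_win; apply: (ent_eq HE) => n n'; split.
    move=> [H1 /win_eq H2 H3]; rewrite H1 H3; congr (_, _, (_, _)); apply/win_eq => j jB.
      by rewrite -!(addnA _ M); apply: H2; rewrite ltn_add2l.
    by apply: H2; rewrite ltn_addr.
  move=> [H1 /win_eq H2 /win_eq H3 H4]; rewrite H1 H4; congr (_, _, _).
  apply/win_eq => j jMB; have [jA|Aj] := ltnP j M; first exact: H3.
  have := H2 (j - M)%N; rewrite -!(addnA _ M) subnKC // => -> //.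
  by rewrite ltn_subLR.
rewrite -(ent_joined_win q M B) -[RHS](ent_shift HE _ A); apply: (ent_eq HE) => n n'.
split=> [[-> -> /res_shift ->]|[-> -> H]] //; by congr (_, _); apply/res_shift.
Qed.

(** By [ent_incr_anti] an increment bounds all later ones. If it were below h A, iterating it k
    times would push the entropy of a window of length k A + M below the rate; adjoining the residue
    costs only a constant. *)
Lemma ent_incr_lower q A M : h * A%:R <= G q (A + M) - G q M.
Proof.
set d := G q (A + M) - G q M.
have step k : G q (k * A + M) <= G q M + k%:R * d.
  elim: k => [|k IH]; first by rewrite mul0n mul0r addr0.
  have := ent_incr_anti q A M (k * A); rewrite addnCA -mulSn [(M + _ * _)%N]addnC [(M + _ * _)%N]addnC.
  rewrite -[k.+1%:R]natr1 mulrDl mul1r => H.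
  rewrite -(lerD2r (G q M)) (le_trans H) // /d.
  by move: IH; rewrite /d; lra.
have low k : k%:R * (h * A%:R) <= G q M + k%:R * d.
  apply: le_trans (step k).
  apply: le_trans (_ : a (k * A + M)%N <= _); last by apply: (ent_det HE) => n n' [->].
  apply: le_trans (ent_rate_le _); rewrite mulrCA -natrM ler_wpM2l ?ent_rate_ge0 //.
  by rewrite ler_nat leq_addr.
have [//|lt] := leP (h * A%:R) d.
have gt0 : 0 < h * A%:R - d by rewrite subr_gt0.
have [k Hk] := exists_nat_gt (G q M / (h * A%:R - d)).
have := low k; move: Hk; rewrite ltr_pdivrMr // mulrBr => h1 h2.
by exfalso; move: h1 h2; lra.
Qed.

End LowEntropy.

Lemma future_le (V T : Type) (v : nat -> V) w w' (g : nat -> T) :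
  (w <= w')%N -> future v w' g -> future v w g.
Proof.
move=> ww [M [q [q0 H]]]; exists M, q; split=> // n n' nq Hv.
by apply: H => // j /andP[wj jM]; apply: Hv; rewrite jM (leq_trans ww wj).
Qed.

(** * Entropy of blocks of a predictor *)

Section BlockEntropy.
Context {R : realType} (E : (nat -> R) -> R) (HE : logmean E).
Context (V : finType) (v : nat -> V).

Definition block m (g : nat -> bool) : nat -> {ffun 'I_m -> bool} :=
  word m (fun j n => g (n + j)%N).

Lemma block_eq m g n n' : block m g n = block m g n' <->
  forall j, (j < m)%N -> g (n + j)%N = g (n' + j)%N.
Proof.
split=> [H j jA|H].
  by have := congr1 (fun f : {ffun 'I_m -> bool} => f (Ordinal jA)) H; rewrite !ffunE.
by apply/ffunP => j; rewrite !ffunE H.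
Qed.

(** The [f]-block is recovered from the [g]-block and the word of disagreements, all of whose m
    letters have the same entropy by shift invariance. *)
Lemma ent_block_diff (T : finType) (Y : nat -> T) m (f g : nat -> bool) :
  ent E (fun n => (Y n, block m f n)) <=
  ent E (fun n => (Y n, block m g n)) + m%:R * ent E (fun n => f n != g n).
Proof.
pose D (j n : nat) := f (n + j)%N != g (n + j)%N.
apply: (@le_trans _ _ (ent E (fun n => ((Y n, block m g n), word m D n)))).
  apply: (ent_det HE) => n n' [-> /block_eq H1 H2]; congr pair; apply/block_eq => j jm.
  have := congr1 (fun f : {ffun 'I_m -> bool} => f (Ordinal jm)) H2.
  rewrite !ffunE /= /D H1 //.
  by case: (f _); case: (f _); case: (g _).
rewrite (le_trans (ent_word_le HE _ _ _)) // lerD2l.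
rewrite (eq_bigr (fun=> ent E (fun n => f n != g n))) => [|j _].
  by rewrite sumr_const card_ord -[leLHS]mulr_natl.
by rewrite -[RHS](ent_shift HE _ j).
Qed.

Lemma ent_block_diff0 m (f g : nat -> bool) :
  ent E (block m f) <= ent E (block m g) + m%:R * ent E (fun n => f n != g n).
Proof.
have P (k : nat -> bool) : ent E (block m k) = ent E (fun n => (tt, block m k n)).
  by apply: (ent_eq HE) => n n'; split=> [[]|->].
by rewrite !P ent_block_diff.
Qed.

(* alpha reads the window of length m + M and beta only what follows it.  When
   they mostly agree, the alpha-block is information shared by the window and its
   future, which is bounded by the excess of the window entropy over the rate. *)
Lemma ent_block_le (alpha beta : nat -> bool) M q m :
  (forall n n', n = n' %[mod q.+1] ->
    (forall j, (j < M)%N -> v (n + j)%N = v (n' + j)%N) -> alpha n = alpha n') ->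
  future v (m + M) beta ->
  ent E (block m alpha) <=
    ent E (win v (m + M)) - ent_rate E v * (m + M)%:R + ln q.+1%:R
    + m%:R * ent E (fun n => alpha n != beta n).
Proof.
move=> Ha [M2 [q2 [q20 Hb]]].
(* [res Q] has modulus Q + 1 = (q + 1) q2, so it determines both the residue used by [alpha] and the
   one used by [beta]. *)
pose A := (m + M)%N; pose Q := (q.+1 * q2).-1; pose M' := (m + M2)%N.
have QE : Q.+1 = (q.+1 * q2)%N by rewrite /Q prednK // muln_gt0.
have resQ n n' : res Q n = res Q n' -> n = n' %[mod q.+1] /\ n = n' %[mod q2].
  move=> /res_eq; rewrite QE => H; split.
    by rewrite -(modn_dvdm n (dvdn_mulr q2 (dvdnn q.+1))) H modn_dvdm // dvdn_mulr.
  by rewrite -(modn_dvdm n (dvdn_mull q.+1 (dvdnn q2))) H modn_dvdm // dvdn_mull.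
pose U := block m alpha; pose X := win v A; pose Y n := win v M' (n + A)%N.
have UX n n' : X n = X n' -> n = n' %[mod q.+1] -> U n = U n'.
  move=> /win_eq HX Hq; apply/block_eq => j jm; apply: Ha.
    by apply/eqP; rewrite eqn_modDr; apply/eqP.
  by move=> i iM; rewrite -!addnA; apply: HX; rewrite /A; lia.
have VY n n' : Y n = Y n' -> n = n' %[mod q2] -> block m beta n = block m beta n'.
  move=> /win_eq HX Hq; apply/block_eq => j jm; apply: Hb.
    by apply/eqP; rewrite eqn_modDr; apply/eqP.
  move=> i /andP[Ai iM]; have := HX (j + i - A)%N.
  have Ek k : (k + A + (j + i - A) = k + j + i)%N by rewrite /A; lia.
  by rewrite !Ek; apply; rewrite /A /M'; lia.
(* Conditioning on the block [U]: it is determined by the window ([h3]) and nearly by the future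
   ([h4]), while given the future the window still carries entropy h A ([h5]). *)
have S := ent_submod HE X (fun n => (Y n, res Q n)) (fun n => (U n, res q n)).
have h1 : ent E (fun n => (X n, Y n, res Q n)) <=
    ent E (fun n => (X n, (Y n, res Q n), (U n, res q n))).
  by apply: (ent_det HE) => n n' [-> -> ->].
have h2 : ent E U <= ent E (fun n => (U n, res q n)).
  by apply: (ent_det HE) => n n' [->].
have h3 : ent E (fun n => (X n, (U n, res q n))) <= ent E X + ln q.+1%:R.
  apply: (@le_trans _ _ (ent E (fun n => (X n, res q n)))).
    apply: (ent_det HE) => n n' [HX Hr]; rewrite HX Hr (UX n n') //.
    by apply/res_eq.
  rewrite (le_trans (ent_pair HE _ _)) // lerD2l.
  by rewrite (le_trans (ent_le_ln HE _)) // card_ord.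
have h4 : ent E (fun n => ((Y n, res Q n), (U n, res q n))) <=
    ent E (fun n => (Y n, res Q n)) + m%:R * ent E (fun n => alpha n != beta n).
  apply: (@le_trans _ _ (ent E (fun n => ((Y n, res Q n), U n)))).
    apply: (ent_det HE) => n n' [-> HQ ->]; rewrite HQ; congr (_, (_, _)).
    by apply/res_eq; have [] := resQ _ _ HQ.
  rewrite (le_trans (ent_block_diff _ _ _ beta)) // lerD2r.
  apply: (ent_det HE) => n n' [HY HQ]; rewrite HY HQ (VY n n') //.
  by have [] := resQ _ _ HQ.
have h5 := ent_incr_lower HE v Q A M'.
rewrite -(ent_joined_win HE) -(ent_shifted_win HE v Q A) in h5.
by move: S h1 h2 h3 h4 h5; rewrite /X /Y /U /A; lra.
Qed.

(** A finite form of the Rokhlin-Sinai argument. [alpha k] reads a bounded window and a much later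
    [alpha i1] reads only beyond it, yet the two nearly agree; so [ent_block_le] leaves only the
    sublinear excess of the window entropy. Divisibility by [d] and the bound [B] serve the nesting
    of scales later. *)
Theorem low_entropy (alpha : nat -> nat -> bool) :
  (forall i, future v i (alpha i)) ->
  (forall e : R, 0 < e -> exists k, forall i, (k <= i)%N ->
     E (fun n => (alpha i n != alpha k n)%:R) <= e) ->
  forall (e : R) (d B : nat), 0 < e -> (0 < d)%N ->
  exists m, [/\ (0 < m)%N, (d %| m)%N, (B <= m)%N &
    exists i0, forall i, (i0 <= i)%N -> ent E (block m (alpha i)) <= e * m%:R].
Proof.
move=> Hfut Hcau e d B e0 d0.
have e4 : 0 < e / 4 by lra.
have [k Hk] : exists k, forall i, (k <= i)%N -> ent E (fun n => alpha i n != alpha k n) <= e / 4.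
  have [|k Hk] := Hcau ((e / 4 / 3) ^+ 2); first by rewrite exprn_gt0 // divr_gt0.
  exists k => i /Hk H; apply: (ent_bool_small HE) => //; exact: ltW.
have [M [q [q0 Hak]]] := Hfut k.
have [C HC] := ent_win_upper HE v e4.
(* K collects the costs that do not grow with m. The final bound has four quarters of e m: replacing
   [alpha i] by [alpha k], the linear window excess, K, and the disagreement of [alpha k] with
   [alpha i1]. *)
pose K := e / 4 * M%:R + C + ln q%:R.
have [t Ht] := exists_nat_gt (K / (e / 4)).
pose m := (d * (t + B).+1)%N.
have tm : (t + B < m)%N by exact: leq_pmull.
have Km : K <= e / 4 * m%:R.
  rewrite -ler_pdivrMl // mulrC (le_trans (ltW Ht)) // ler_nat; lia.
exists m; split; [lia|exact: dvdn_mulr|lia|].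
exists k => i ki.
have diff j : (k <= j)%N -> m%:R * ent E (fun n => alpha j n != alpha k n) <= e / 4 * m%:R.
  by move=> /Hk H; rewrite mulrC ler_wpM2r.
rewrite (le_trans (ent_block_diff0 _ _ (alpha k))) //.
pose i1 := maxn k (m + M).
have Hf1 : future v (m + M) (alpha i1) by apply: future_le (Hfut i1); exact: leq_maxr.
have := @ent_block_le (alpha k) (alpha i1) M q.-1 m _ Hf1; rewrite prednK // => H.
have {H} := H _; rewrite (_ : ent E (fun n => alpha k n != alpha i1 n) = ent E (fun n => alpha i1 n != alpha k n)); last first.
  by congr (ent E _); apply/funext => n; rewrite eq_sym.
move=> H.
have h1 := H (fun n n' Hn Hv => Hak n n' Hn (fun j Hj => Hv j (proj2 (andP Hj)))).
have h2 := diff i ki; have h3 := diff i1 (leq_maxl _ _); have h4 := HC (m + M)%N.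
move: h1 h2 h3 h4 Km; rewrite /K natrD; lra.
Qed.

End BlockEntropy.

(** * Aligned blocks and their typical words *)

Definition cut m (g : nat -> bool) (k : nat) : seq bool :=
  mkseq (fun r => g (k * m + r)%N) m.

Section Aligned.
Context {R : realType} (E : (nat -> R) -> R) (HE : logmean E).

Lemma cut_block m g k : cut m g k = codom (block m g (k * m)).
Proof.
rewrite /cut /mkseq -val_enum_ord -map_comp; apply: eq_map => j /=.
by rewrite ffunE.
Qed.

(* For every residue r, an aligned block is covered by two consecutive blocks
   starting at r modulo m; average over r. *)
Lemma ent_aligned m (g : nat -> bool) : (0 < m)%N ->
  ent E (fun n => block m g (n * m)%N) <= 2 * ent E (block m g).
Proof.
move=> m0; set U := ent E _.
have m0R : 0 < m%:R :> R by rewrite ltr0n.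
have H r : (r < m)%N -> U <= 2 * ent E (fun n => block m g (n * m + r)%N).
  move=> rm; pose B n := block m g (n * m + r)%N.
  apply: (@le_trans _ _ (ent E (fun n => (B n, B (n + 1)%N)))); last first.
    by rewrite (le_trans (ent_pair HE _ _)) // (ent_shift HE B) mulr_natl.
  (* The aligned block number n + 1 lies inside the two consecutive blocks that start at n m + r. *)
  rewrite /U -(ent_shift HE _ 1); apply: (ent_det HE) => n n'.
  rewrite /B => -[/block_eq H1 /block_eq H2]; apply/block_eq => j jm.
  have [lt|ge] := leqP r (m + j - r + r).
    have [jr|rj] := ltnP j r.
      have := H1 (m + j - r)%N; have F k : (k * m + r + (m + j - r) = (k + 1) * m + j)%N by lia.
      by rewrite !F; apply; lia.
    have := H2 (j - r)%N; have F k : ((k + 1) * m + r + (j - r) = (k + 1) * m + j)%N by lia.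
    by rewrite !F; apply; lia.
  by lia.
rewrite -(ler_pM2l m0R).
apply: (@le_trans _ _ (2 * \sum_(r < m) ent E (fun n => block m g (n * m + r)%N))).
  have -> : m%:R * U = \sum_(r < m) U by rewrite sumr_const card_ord mulr_natl.
  rewrite mulr_sumr.
  by apply: ler_sum => r _; apply: H.
rewrite mulrCA ler_pM2l //; exact: (ent_progressions HE).
Qed.

(** [W] consists of the typical words of one predictor [alpha i1], and serves all later ones because
    they rarely differ from it on a whole block. *)
Lemma aligned_words (V : finType) (v : nat -> V) (alpha : nat -> nat -> bool) :
  (forall i, future v i (alpha i)) ->
  (forall e : R, 0 < e -> exists k, forall i, (k <= i)%N ->
     E (fun n => (alpha i n != alpha k n)%:R) <= e) ->
  forall (e : R) (d : nat), 0 < e -> (0 < d)%N ->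
  exists m (W : seq (seq bool)) i1, [/\ (0 < m)%N, (d %| m)%N,
    (size W).+1%:R <= expR (e * m%:R) & forall i, (i1 <= i)%N ->
      E (fun n => (cut m (alpha i) n \notin W)%:R) <= e].
Proof.
move=> Hfut Hcau e d e0 d0.
(* Aligned blocks then have entropy at most e^2 m / 4, and Markov at level t = e m / 2 leaves an
   atypical part of at most e / 2. The bound e m >= 2 below gives exp t >= 2, which absorbs the
   extra word in (size W).+1. *)
have e80 : 0 < e ^+ 2 / 8 by rewrite divr_gt0 ?exprn_gt0.
have [B HB] := exists_nat_gt (2 / e).
have [m [m0 dm Bm [i0 Hent]]] := low_entropy HE Hfut Hcau B e80 d0.
have m0R : 0 < m%:R :> R by rewrite ltr0n.
have [k Hk] := Hcau (e / (4 * m%:R)) (divr_gt0 e0 (mulr_gt0 (ltr0Sn R 3) m0R)).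
pose i1 := maxn k i0.
pose t := e / 2 * m%:R.
have em2 : 2 <= e * m%:R.
  by rewrite mulrC -ler_pdivrMr // (le_trans (ltW HB)) // ler_nat.
have t0 : 0 < t by rewrite mulr_gt0 // divr_gt0.
pose U i n := block m (alpha i) (n * m)%N.
pose W0 := [pred a | expR (- t) <= law E (U i1) a].
exists m, [seq codom f | f : {ffun 'I_m -> bool} in W0], i1.
split=> //.
  rewrite size_map -cardE -natr1.
  have -> : e * m%:R = t + t by rewrite /t; lra.
  rewrite expRD; have := card_typical HE (U i1) t.
  have := @expR_ge1Dx R t; have t1 : 1 <= t by rewrite /t; lra.
  rewrite -/W0; move: (#|_|%:R) (expR t) => x y h1 h2.
  have : 2 * y <= y * y by apply: ler_wpM2r; lra.
  lra.
move=> i i1i.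
have dist j : (i1 <= j)%N -> E (fun n => (alpha j n != alpha i1 n)%:R) <= e / (2 * m%:R).
  move=> hj.
  apply: (@le_trans _ _ (E (fun n => (alpha j n != alpha k n)%:R + (alpha i1 n != alpha k n)%:R))).
    apply: (lm_mono HE) => //; first exact: bddD.
    by move=> n; case: (alpha j n); case: (alpha i1 n); case: (alpha k n); rewrite /= ?addr0 ?add0r ?lexx ?ler01 // addr_ge0.
  rewrite (lmD HE) //; have := Hk j (leq_trans (leq_maxl _ _) hj).
  have := Hk i1 (leq_maxl _ _).
  have -> : e / (2 * m%:R) = e / (4 * m%:R) + e / (4 * m%:R).
    by field; rewrite gt_eqF.
  lra.
have inW j n : (cut m (alpha j) n \in [seq codom f | f : {ffun 'I_m -> bool} in W0]) = (U j n \in W0).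
  rewrite cut_block -/(U j n); apply/mapP/idP => [[f]|H].
    by rewrite mem_enum !codom_ffun => fW /val_inj /(can_inj fgraphK) ->.
  by exists (U j n); rewrite ?mem_enum.
(* Union bound: either the block of [alpha i1] is atypical, or [alpha i] differs from it at one of
   the m places. *)
apply: (@le_trans _ _ (E (fun n => (U i1 n \notin W0)%:R + \sum_(r < m) (alpha i (n * m + r)%N != alpha i1 (n * m + r)%N)%:R))).
  apply: (lm_mono HE) => //.
    by apply: bddD => //; apply: bdd_sum => r; apply: bdd_bool.
  move=> n; rewrite inW.
  have [uW|uW] := boolP (U i1 n \notin W0); first by rewrite (le_trans (_ : _ <= 1)) ?lern1 ?leq_b1 // lerDl sumr_ge0.
  have [eq|/negP neq] := boolP (U i n == U i1 n).
    by rewrite (eqP eq) (negbTE uW) add0r sumr_ge0.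
  have [r Hr] : exists r : 'I_m, alpha i (n * m + r)%N != alpha i1 (n * m + r)%N.
    apply: contrapT => /forallNP H; apply: neq; apply/eqP/ffunP => r; rewrite !ffunE.
    by apply/eqP; apply/negPn/negP; exact: H.
  rewrite (le_trans (_ : _ <= 1)) ?lern1 ?leq_b1 // add0r (bigD1 r) //= Hr.
  by rewrite lerDl sumr_ge0.
rewrite (lmD HE) //; last by apply: bdd_sum => r; apply: bdd_bool.
rewrite (lm_sum HE) //.
rewrite (lm_progressions HE m0 (g := fun n => (alpha i n != alpha i1 n)%:R)) //.
have h1 : m%:R * E (fun n => (alpha i n != alpha i1 n)%:R) <= e / 2.
  apply: (@le_trans _ _ (m%:R * (e / (2 * m%:R)))); first by rewrite ler_pM2l // dist.
  by rewrite le_eqVlt; apply/orP; left; apply/eqP; field; rewrite gt_eqF.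
have h2 : E (fun n => (U i1 n \notin W0)%:R) <= e / 2.
  rewrite (le_trans (atypical_le HE (U i1) t0)) // ler_pdivrMr //.
  rewrite (le_trans (ent_aligned _ m0)) //.
  have := Hent i1 (leq_maxr _ _); rewrite /t.
  have -> : e / 2 * (e / 2 * m%:R) = 2 * (e ^+ 2 / 8 * m%:R) by field.
  lra.
lra.
Qed.

End Aligned.

(** * Gluing low-entropy sequences *)

(** One scale m for each e is enough: concatenating aligned words controls all longer factors. Words
    are sequences, so that those of different lengths share one type. *)
Definition low_complexity (R : realType) (f : nat -> bool) : Prop :=
  forall e : R, 0 < e -> exists m (W : seq (seq bool)) K0, [/\ (0 < m)%N,
    (size W)%:R <= expR (e * m%:R) & forall k, (K0 <= k)%N -> cut m f k \in W].

(* At stage s, beta s is erased on every m j-block, j <= s, whose word is not in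
   W j.  By nesting, an m j-block of the result is either zero or a word of W j
   with its own bad sub-blocks erased, whence the bound by (size (W j)).+1. *)
Lemma nested_blocks (R : realType) (X : nat -> nat) (m : nat -> nat)
    (W : nat -> seq (seq bool)) (beta : nat -> nat -> bool) (st : nat -> nat) (e : nat -> R) :
  (forall j, 0 < m j)%N -> (forall j, m j %| m j.+1)%N ->
  (forall s, X s <= X s.+1)%N -> (forall s, m s %| X s)%N ->
  (forall n, X (st n) <= n < X (st n).+1)%N ->
  (forall j, (size (W j)).+1%:R <= expR (e j * (m j)%:R)) ->
  (forall d : R, 0 < d -> exists j, e j <= d) ->
  low_complexity R (fun n => beta (st n) n &&
    all (fun j => cut (m j) (beta (st n)) (n %/ m j) \in W j) (iota 0 (st n).+1)).
Proof.
move=> m0 mdv1 X1 mX Hst HW He d d0.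
have mdv j j' : (j <= j')%N -> (m j %| m j')%N.
  move=> /subnK <-; elim: (j' - j)%N => [|t IH]; first exact: dvdnn.
  by rewrite addSn (dvdn_trans IH).
have Xmono s s' : (s <= s')%N -> (X s <= X s')%N.
  by move=> /subnK <-; elim: (s' - s)%N => [//|t IH]; rewrite addSn (leq_trans IH).
have st_eq n s : (X s <= n < X s.+1)%N -> st n = s.
  move=> /andP[h1 h2]; have /andP[h3 h4] := Hst n.
  apply/eqP; rewrite eqn_leq; apply/andP; split; rewrite leqNgt; apply/negP => lt.
    by have := Xmono _ _ lt; lia.
  by have := Xmono _ _ lt; lia.
have [j Hj] := He d d0; set M := m j.
(* [Z u] is [u] with its bad sub-blocks of scales below j erased; it depends on [u] alone. *)
pose Z (u : seq bool) := mkseq (fun r => nth false u r &&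
  all (fun i => mkseq (fun t => nth false u (r %/ m i * m i + t)%N) (m i) \in W i) (iota 0 j)) M.
exists M, (nseq M false :: [seq Z u | u <- W j]), (X j); split; [exact: m0| |].
  by rewrite /= size_map (le_trans (HW j)) // ler_expR ler_wpM2r.
move=> k Xk; set s := st (k * M).
have js : (j <= s)%N.
  rewrite leqNgt; apply/negP => lt; have /andP[_] := Hst (k * M)%N.
  rewrite -/s ltnNge => /negP; apply; apply: leq_trans (Xmono _ _ lt) _.
  by rewrite (leq_trans Xk) // leq_pmulr //; exact: m0.
(* M divides X (s + 1), so no stage ends inside an M-block. *)
have stM r : (r < M)%N -> st (k * M + r) = s.
  move=> rM; apply: st_eq; have /andP[h1 h2] := Hst (k * M)%N.
  rewrite -/s in h1 h2; rewrite (leq_trans h1) ?leq_addr //=.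
  have /dvdnP[t Ht] : (M %| X s.+1)%N by rewrite (dvdn_trans _ (mX _)) // mdv // ltnW.
  rewrite Ht in h2 *; rewrite ltn_pmul2r // in h2; last exact: m0.
  by apply: leq_trans (_ : (k.+1 * M <= _)%N); rewrite ?leq_mul2r ?h2 ?orbT // mulSn [(_ + _ * _)%N]addnC ltn_add2l.
have E1 : cut M (fun n => beta (st n) n &&
    all (fun j => cut (m j) (beta (st n)) (n %/ m j) \in W j) (iota 0 (st n).+1)) k =
  mkseq (fun r => beta s (k * M + r)%N &&
    all (fun i => cut (m i) (beta s) ((k * M + r) %/ m i) \in W i) (iota 0 s.+1)) M.
  by apply/eq_in_map => r; rewrite mem_iota add0n => /andP[_ rM]; rewrite stM.
rewrite E1.
(* A block of scale i >= j contains the whole M-block, so the tests at these scales keep or erase it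
   as a whole. *)
have up i r : (j <= i)%N -> (r < M)%N -> ((k * M + r) %/ m i = (k * M) %/ m i)%N.
  move=> ji rM; have /dvdnP[t Ht] := mdv _ _ ji; rewrite Ht -/M [(t * M)%N]mulnC !divnMA.
  by rewrite divnMDl ?(divn_small rM) ?addn0 ?mulnK ?m0 //; exact: m0.
have [bad|good] := boolP (has (fun i => cut (m i) (beta s) (k * M %/ m i) \notin W i) (iota j (s.+1 - j))).
  rewrite inE; apply/orP; left; apply/eqP.
  apply: (@eq_from_nth _ false); rewrite size_mkseq ?size_nseq // => r rM.
  rewrite nth_nseq nth_mkseq // if_same; apply/negbTE; rewrite negb_and; apply/orP; right.
  have /hasP[i] := bad; rewrite mem_iota (subnKC (leqW js)) => /andP[ji is1] ni.
  by apply/allPn; exists i; rewrite ?mem_iota //= up.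
rewrite inE; apply/orP; right.
have goodi i : (j <= i <= s)%N -> cut (m i) (beta s) (k * M %/ m i) \in W i.
  move=> /andP[ji is1]; apply/negPn/negP => ni; move/negP: good; apply; apply/hasP; exists i => //.
  by rewrite mem_iota (subnKC (leqW js)) ji.
apply/mapP; exists (cut M (beta s) k).
  by have := goodi j; rewrite leqnn js mulnK ?m0 //; apply.
apply/eq_in_map => r; rewrite mem_iota add0n => /andP[_ rM].
rewrite /cut nth_mkseq //; congr (_ && _).
rewrite -[s.+1](subnKC (leqW js)) iotaD all_cat add0n.
rewrite [X in _ && X](_ : _ = true) ?andbT; last first.
  apply/allP => i; rewrite mem_iota (subnKC (leqW js)) => /andP[ji is1].
  by rewrite up //; apply: goodi; rewrite ji.
apply: eq_in_all => i; rewrite mem_iota add0n => /andP[_ ij]; apply: (congr1 (fun x => x \in W i)).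
apply/eq_in_map => t; rewrite mem_iota add0n => /andP[_ ti].
have /dvdnP[q Hq] := mdv _ _ (ltnW ij).
have lt : (r %/ m i * m i + t < M)%N.
  have : (r %/ m i < q)%N by rewrite ltn_divLR // -Hq.
  move=> h; rewrite /M Hq; apply: leq_trans (_ : ((r %/ m i).+1 * m i <= _)%N).
    by rewrite mulSn [(_ + _ * _)%N]addnC ltn_add2l.
  by rewrite leq_mul2r h orbT.
rewrite nth_mkseq //; congr (beta s _).
by rewrite /M Hq mulnA divnMDl // mulnDl addnA.
Qed.

Section Glue.
Context {R : realType} (E : (nat -> R) -> R) (HE : logmean E).

Lemma sum_halves (s : nat) : \sum_(j < s) (2 ^+ j)^-1 <= 2 :> R.
Proof.
suff -> : \sum_(j < s) (2 ^+ j)^-1 = 2 - 2 * (2 ^+ s)^-1 :> R.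
  by rewrite gerBl mulr_ge0 // invr_ge0 exprn_ge0.
elim: s => [|s IH]; first by rewrite big_ord0 expr0 invr1 mulr1 subrr.
rewrite big_ord_recr /= IH exprS invfM; field.
by rewrite expf_neq0.
Qed.

(** Fewer than X terms differ, each by at most 2 / n <= 2. *)
Lemma lavg_tail (f g : nat -> R) (X N : nat) : (0 < N)%N ->
  (forall n, `|f n| <= 1) -> (forall n, `|g n| <= 1) ->
  (forall n, (X <= n <= N)%N -> f n = g n) ->
  lavg f N <= lavg g N + 2 * X%:R / harm N.
Proof.
move=> N0 Hf Hg H; have h0 : 0 < @harm R N by exact: harm_gt0.
rewrite /lavg mulrC [(harm N)^-1 * _]mulrC -mulrDl ler_pM2r ?invr_gt0 //.
rewrite -lerBlDl -sumrB.
apply: (@le_trans _ _ (\sum_(1 <= n < N.+1) (n < X)%:R * 2)).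
  rewrite big_nat [leRHS]big_nat; apply: ler_sum => n /andP[n0 nN].
  rewrite -mulrBl; case: (ltnP n X) => [nX|Xn].
    rewrite mul1r (le_trans (ler_norm _)) // normrM (ger0_norm (_ : 0 <= n%:R^-1)) ?invr_ge0 //.
    rewrite ler_pdivrMr ?ltr0n // (le_trans (ler_normB _ _)) //.
    rewrite (le_trans (lerD (Hf n) (Hg n))) // -[1 + 1]/(2%:R) ler_peMr //.
    by rewrite ler1n.
  by rewrite H ?Xn // subrr mul0r mul0r.
rewrite -mulr_suml mulrC ler_pM2l // -natr_sum ler_nat.
rewrite -big_mkcond /= sum1_count -size_filter.
rewrite -[leqRHS](size_iota 0 X) uniq_leq_size ?filter_uniq ?iota_uniq // => n.
by rewrite mem_filter mem_iota => /andP[].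
Qed.

(** At each stage the erasures have density at most c / 4, so the correlation stays above c / 2.
    Stage s runs beyond some N where this shows in the logarithmic average, and the earlier stages
    spoil at most c / 4 of it. *)
Theorem glue (g : nat -> R) (V : finType) (v : nat -> V) (alpha : nat -> nat -> bool) (c : R) :
  (forall n, `|g n| <= 1) ->
  (forall i, future v i (alpha i)) ->
  (forall e : R, 0 < e -> exists k, forall i, (k <= i)%N ->
     E (fun n => (alpha i n != alpha k n)%:R) <= e) ->
  0 < c -> (forall i, c <= E (fun n => (alpha i n)%:R * g n)) ->
  exists2 f, low_complexity R f &
    forall N0, exists2 N, (N0 <= N)%N & c / 4 <= lavg (fun n => (f n)%:R * g n) N.
Proof.
move=> Hg Hfut Hcau c0 Hc.
have bg : bdd g by exists 1.
(* The halving makes the errors of all scales sum to at most c / 4. *)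
pose e (j : nat) : R := c / 8 / 2 ^+ j.
have e0 j : 0 < e j by rewrite /e !divr_gt0 // exprn_gt0.
have /choice[F HF] : forall jd : nat * nat, exists mWi : nat * seq (seq bool) * nat,
    (0 < jd.2)%N -> [/\ (0 < mWi.1.1)%N, (jd.2 %| mWi.1.1)%N,
      (size mWi.1.2).+1%:R <= expR (e jd.1 * mWi.1.1%:R) & forall i, (mWi.2 <= i)%N ->
      E (fun n => (cut mWi.1.1 (alpha i) n \notin mWi.1.2)%:R) <= e jd.1].
  move=> [j d]; case: d => [|d]; first by exists (0, [::], 0)%N.
  have [m [W [i H]]] := aligned_words HE Hfut Hcau (e0 j) (ltn0Sn d).
  by exists (m, W, i).
(* Each scale is requested as a multiple of the previous one, so that the blocks nest. *)
pose D := fix D j := if j is i.+1 then (F (i, D i)).1.1 else 1%N.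
have D0 j : (0 < D j)%N.
  by elim: j => // j IH /=; have [] := HF (j, D j) IH.
pose m j := D j.+1; pose W j := (F (j, D j)).1.2; pose ix j := (F (j, D j)).2.
have HFj j := HF (j, D j) (D0 j).
(* Stage s uses a predictor late enough for the word lists of all scales j <= s. *)
pose I s := \max_(j < s.+1) ix j.
pose beta s := alpha (I s).
have HI j s : (j <= s)%N -> (ix j <= I s)%N.
  by move=> js; apply: (@leq_bigmax _ (fun j : 'I_s.+1 => ix j) (Ordinal (js : (j < s.+1)%N))).
have bad_le j s : (j <= s)%N -> E (fun n => (cut (m j) (beta s) n \notin W j)%:R) <= e j.
  by move=> /HI; have [_ _ _] := HFj j; apply.
have m0 j : (0 < m j)%N by exact: D0.
pose good s n := all (fun j => cut (m j) (beta s) (n %/ m j) \in W j) (iota 0 s.+1).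
pose h s n := beta s n && good s n.
have hcor s : c / 2 < E (fun n => (h s n)%:R * g n).
  have bad : E (fun n => (~~ good s n)%:R) <= c / 4.
    apply: (@le_trans _ _ (E (fun n => \sum_(j < s.+1) (cut (m j) (beta s) (n %/ m j)%N \notin W j)%:R))).
      apply: (lm_mono HE) => //; first by apply: bdd_sum => j; apply: bdd_bool.
      move=> n; have [|/allPn[j]] := boolP (good s n); first by rewrite sumr_ge0.
      rewrite mem_iota add0n => /andP[_ js] nW.
      by rewrite (bigD1 (Ordinal js)) //= nW lerDl sumr_ge0.
    rewrite (lm_sum HE) //.
    apply: (@le_trans _ _ (\sum_(j < s.+1) e j)).
      apply: ler_sum => j _.
      rewrite (lm_divn HE (m0 j) (G := fun n => (cut (m j) (beta s) n \notin W j)%:R)) //.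
      by apply: bad_le; rewrite -ltnS.
    rewrite -mulr_sumr; have c8 : 0 <= c / 8 by lra.
    have := ler_wpM2l c8 (sum_halves s.+1); lra.
  have : E (fun n => (beta s n)%:R * g n) <= E (fun n => (h s n)%:R * g n + (~~ good s n)%:R).
    apply: (lm_mono HE); [exact: bddM|by apply: bddD => //; exact: bddM|].
    move=> n; rewrite /h; case: (good s n); rewrite ?andbT ?addr0 // andbF mul0r add0r.
    by case: (beta s n); rewrite ?mul1r ?mul0r // (le_trans (ler_norm _)).
  rewrite (lmD HE) //; last exact: bddM.
  have := Hc (I s); rewrite -/(beta s); move: bad; lra.
have /choice[H HH] : forall X : nat, exists K, forall N, (K <= N)%N -> 2 * X%:R / (c / 4) <= @harm R N.
  by move=> X; exact: harm_unbounded.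
have /choice[NN HN] : forall sB : nat * nat, exists N, (sB.2 <= N)%N /\ c / 2 < lavg (fun n => (h sB.1 n)%:R * g n) N.
  move=> [s B]; have [|N h1 h2] := lm_gtP HE B (_ : bdd _) (hcor s); first exact: bddM.
  by exists N.
(* Stage s lasts until the logarithmic weight of [0, X s) is negligible. *)
pose Ns s X := NN (s, maxn (H X) X.+1).
pose X := fix X s := if s is i.+1 then (m i.+1 * (Ns i (X i)).+1)%N else 0%N.
have XN s : (X s < Ns s (X s) < X s.+1)%N.
  have [/= h1 _] := HN (s, maxn (H (X s)) (X s).+1).
  rewrite (leq_trans (leq_maxr _ _) h1) /=.
  exact: leq_pmull.
have Xlt s : (X s < X s.+1)%N by have /andP[h1 h2] := XN s; exact: ltn_trans h2.
have Xs s : (s <= X s)%N by elim: s => // s IH; exact: leq_ltn_trans (Xlt s).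
have /choice[st Hst] : forall n, exists s, (X s <= n < X s.+1)%N.
  move=> n.
  have ex : exists t, (X t <= n)%N by exists 0%N.
  have ub t : (X t <= n)%N -> (t <= n)%N by exact: leq_trans.
  case: (ex_maxnP ex ub) => t h1 h2; exists t; rewrite h1 /= ltnNge.
  by apply/negP => lt; have := h2 t.+1 lt; rewrite ltnn.
exists (fun n => h (st n) n).
  apply: (@nested_blocks R X m W beta st e) => //.
  - by move=> j; have [] := HFj j.+1.
  - by move=> s; exact: ltnW.
  - by case=> [|s]; [exact: dvdn0|exact: dvdn_mulr].
  - by move=> j; have [] := HFj j.
  move=> d d0; have [t Ht] := exists_nat_gt (c / 8 / d).
  exists t; rewrite /e ler_pdivrMr ?exprn_gt0 // [d * _]mulrC -ler_pdivrMr //.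
  by rewrite (le_trans (ltW Ht)) // -natrX ler_nat ltnW // ltn_expl.
move=> N0; pose s := N0; exists (Ns s (X s)).
  by have /andP[h1 _] := XN s; rewrite (leq_trans (Xs _)) // ltnW.
set N := Ns s (X s); have /andP[XsN NX] := XN s.
have Npos : (0 < N)%N by exact: leq_ltn_trans XsN.
have st_eq n : (X s <= n <= N)%N -> st n = s.
  move=> /andP[h1 h2]; have /andP[h3 h4] := Hst n.
  have Xmono a b : (a <= b)%N -> (X a <= X b)%N.
    move=> /subnK <-; elim: (b - a)%N => [//|t IH]; rewrite addSn; exact: leq_trans (ltnW (Xlt _)).
  apply/eqP; rewrite eqn_leq; apply/andP; split; rewrite leqNgt; apply/negP => lt.
    by have := Xmono _ _ lt; lia.
  by have := Xmono _ _ lt; lia.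
have b1 (k : nat -> bool) n : `|(k n)%:R * g n| <= 1 :> R.
  by case: (k n); rewrite ?mul1r // mul0r normr0.
have T := @lavg_tail (fun n => (h s n)%:R * g n) (fun n => (h (st n) n)%:R * g n) (X s) N Npos
  (b1 _) (b1 (fun n => h (st n) n)).
have {}T := T (fun n hn => congr1 (fun t => (h t n)%:R * g n) (esym (st_eq n hn))).
have [/= h1 h2] := HN (s, maxn (H (X s)) (X s).+1).
rewrite -/(Ns s (X s)) -/N in h1 h2.
have h3 : 2 * (X s)%:R / harm N <= c / 4.
  rewrite ler_pdivrMr ?harm_gt0 // [c / 4 * _]mulrC -ler_pdivrMr ?divr_gt0 //.
  by apply: HH; exact: leq_trans (leq_maxl _ _) h1.
move: T h2 h3; lra.
Qed.

End Glue.

(** * The orbit closure of a low-complexity sequence *)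

Fixpoint concats (W : seq (seq bool)) q : seq (seq bool) :=
  if q is p.+1 then [seq u ++ w | u <- concats W p, w <- W] else [:: [::]].

Lemma size_concats W q : size (concats W q) = (size W ^ q)%N.
Proof. by elim: q => //= q IH; rewrite size_allpairs IH expnSr. Qed.

Lemma factor_concats m W f K0 a q :
  (forall k, (K0 <= k)%N -> cut m f k \in W) -> (K0 <= a)%N ->
  mkseq (fun j => f (a * m + j)%N) (q * m) \in concats W q.
Proof.
move=> HW Ka; elim: q => [|q IH] /=; first by rewrite mem_seq1.
rewrite /mkseq mulSn addnC iotaD map_cat; apply: allpairs_f => //.
rewrite add0n -[(q * m)%N]addn0 iotaDl -map_comp.
suff -> : [seq f (a * m + (q * m + j))%N | j <- iota 0 m] = cut m f (a + q).
  by apply: HW; exact: leq_trans (leq_addr _ _).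
by apply: eq_map => j; rewrite mulnDl addnA.
Qed.

(** A factor of f either starts among the first K0 m places or is cut out of q consecutive good
    blocks at one of m offsets. This gives at most K0 m + m |W|^q words, and the constants are
    absorbed by half of the exponent. *)
Lemma factor_count (R : realType) f : low_complexity R f ->
  forall (d : R) K, 0 < d -> exists N0, forall n, (N0 <= n)%N ->
  forall S : seq (seq bool), uniq S ->
    (forall w, w \in S -> exists k, w = mkseq (fun j => f (k + j)%N) (n + K)) ->
  (size S)%:R <= expR (d * n%:R).
Proof.
move=> Hf d K d0; have d2 : 0 < d / 2 by rewrite divr_gt0.
have [m [W [K0 [m0 WE HW]]]] := Hf _ d2.
pose C : R := K0%:R * m%:R + m%:R * expR (d / 2 * (K%:R + 2 * m%:R)).
have [N0 HN0] := exists_nat_gt (C / (d / 2)).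
exists N0 => n Nn S uS HS.
(* The two extra blocks cover the offset on the left and the remainder on the right. *)
set l := (n + K)%N; pose q := (l %/ m + 2)%N.
pose big := [seq mkseq (fun j => f (k + j)%N) l | k <- iota 0 (K0 * m)] ++
  [seq take l (drop r u) | r <- iota 0 m, u <- concats W q].
have Sb : (size S <= size big)%N.
  apply: uniq_leq_size => // w /HS[k ->]; rewrite mem_cat.
  have [kK|Kk] := ltnP k (K0 * m).
    by apply/orP; left; apply/mapP; exists k => //; rewrite mem_iota.
  apply/orP; right; apply/allpairsP.
  exists ((k %% m)%N, mkseq (fun j => f (k %/ m * m + j)%N) (q * m)); split.
  - by rewrite mem_iota add0n ltn_pmod.
  - by apply: factor_concats HW _; rewrite leq_divRL.
  rewrite /= /mkseq -map_drop -map_take drop_iota take_iota add0n.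
  have -> : minn l (q * m - k %% m) = l.
    apply/minn_idPl.
    have : (k %% m + l <= q * m)%N.
      rewrite /q mulnDl mul2n -addnn; move: (divn_eq l m) (ltn_pmod l m0) (ltn_pmod k m0).
      move: (l %/ m * m)%N (l %% m)%N (k %% m)%N => x y z; clear; lia.
    by lia.
  rewrite -[(k %% m)%N]addn0 iotaDl -map_comp; apply: eq_map => j /=.
  by rewrite addnA -divn_eq.
apply: (@le_trans _ _ (size big)%:R); first by rewrite ler_nat.
rewrite size_cat size_map size_iota size_allpairs size_iota size_concats.
rewrite natrD !natrM natrX.
apply: (@le_trans _ _ (C * expR (d / 2 * n%:R))).
  rewrite mulrDl lerD //.
    apply: ler_peMr; first exact: mulr_ge0.
    by rewrite -[leLHS]expR0 ler_expR mulr_ge0 // ltW.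
  rewrite -mulrA ler_wpM2l // -expRD -mulrDr.
  apply: (@le_trans _ _ (expR (d / 2 * m%:R) ^+ q)).
    by rewrite lerXn2r ?nnegrE ?expR_ge0.
  rewrite -expRM_natl ler_expR mulrCA; apply: ler_wpM2l; first exact: ltW.
  rewrite -!natrM -!natrD ler_nat /q mulnDl.
  by have := leq_divM l m; rewrite {2}/l; lia.
have -> : d * n%:R = d / 2 * n%:R + d / 2 * n%:R by lra.
rewrite expRD ler_wpM2r ?expR_ge0 //.
apply: (@le_trans _ _ (1 + d / 2 * n%:R)); last exact: expR_ge1Dx.
rewrite -[leLHS]add0r lerD // mulrC -ler_pdivrMr // (le_trans (ltW HN0)) // ler_nat //.
Qed.

(** Membership of x in the closure of the shift orbit of f. *)
Definition factors_in (f x : nat -> bool) : Prop :=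
  forall n, exists k, forall j, (j < n)%N -> x j = f (k + j)%N.

(* R is a phantom parameter: it lets the metric structure be inferred from the
   type. *)
Definition hull (R : realType) (f : nat -> bool) : Type := {x : nat -> bool | `[< factors_in f x >]}.
HB.instance Definition _ (R : realType) (f : nat -> bool) := Choice.on (hull R f).

Section Hull.
Context {R : realType} (f : nat -> bool).

(* Without the clause 0 < e the triangle axiom fails, as it also quantifies over
   negative radii. *)
Definition hull_ball (x : hull R f) (e : R) (y : hull R f) : Prop :=
  0 < e /\ forall k, e * k.+1%:R <= 1 -> val x k = val y k.

Let ent := entourage_ hull_ball.
Let nbhs' (x : hull R f) : set_system (hull R f) := nbhs_ ent x.
HB.instance Definition _ := hasNbhs.Build (hull R f) nbhs'.

Let hull_ball_center x (e : R) : 0 < e -> hull_ball x e x.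
Proof. by []. Qed.

Let hull_ball_sym x y (e : R) : hull_ball x e y -> hull_ball y e x.
Proof. by move=> [e0 H]; split=> // k /H. Qed.

Let hull_ball_triangle x y z e1 e2 :
  hull_ball x e1 y -> hull_ball y e2 z -> hull_ball x (e1 + e2) z.
Proof.
move=> [e10 H1] [e20 H2]; split=> [|k Hk]; first exact: addr_gt0.
rewrite H1; last by rewrite (le_trans _ Hk) // ler_wpM2r // lerDl ltW.
by rewrite H2 // (le_trans _ Hk) // ler_wpM2r // lerDr ltW.
Qed.

HB.instance Definition _ := @Nbhs_isPseudoMetric.Build R (hull R f)
  ent erefl hull_ball hull_ball_center hull_ball_sym hull_ball_triangle erefl.

Lemma hull_hausdorff : hausdorff_space (hull R f).
Proof.
move=> p q pq; apply: val_inj; apply/funext => k.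
have e0 : 0 < k.+1%:R^-1 :> R by rewrite invr_gt0.
have [z [[_ Hp] [_ Hq]]] := pq _ _ (nbhsx_ballx p _ e0) (nbhsx_ballx q _ e0).
by rewrite Hp ?Hq // mulVf // pnatr_eq0.
Qed.

Lemma hull_nbhsP (p : hull R f) (A : set (hull R f)) : nbhs p A ->
  exists n, forall y, (forall k, (k < n)%N -> val p k = val y k) -> A y.
Proof.
move=> /nbhs_ballP[e /= e0 HA].
exists (Num.truncn e^-1).+1 => y Hy; apply: HA; split=> // k Hk; apply: Hy.
rewrite -(ltr_nat R); apply: lt_le_trans (_ : k.+1%:R <= _); first by rewrite ltr_nat.
apply: (@le_trans _ _ e^-1); first by rewrite -ler_pdivlMl // mulr1 in Hk.
by rewrite ltW // truncnS_gt.
Qed.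

(** An ultrafilter decides every coordinate. Each prefix of the resulting point is the prefix of
    some point of the hull, so the limit stays in the hull. *)
Lemma hull_compact : compact [set: hull R f].
Proof.
rewrite compact_ultra => F UF _.
have PF := @ultra_proper _ _ UF.
pose b k := `[< F [set x : hull R f | val x k] >].
have Fb k : F [set x : hull R f | val x k = b k].
  rewrite /b; case: asboolP => H; first exact: H.
  have [//|H'] := in_ultra_setVsetC [set x : hull R f | val x k] UF.
  apply: filterS H' => x /=; by case: (val x k).
have Fn n : F [set x : hull R f | forall k, (k < n)%N -> b k = val x k].
  elim: n => [|n IH]; first by apply: filterE.
  apply: filterS2 IH (Fb n) => x /= H Hn k; rewrite ltnS leq_eqVlt => /orP[/eqP ->//|].
  exact: H.
have bP : `[< factors_in f b >].
  apply/asboolP => n; have [x Hx] := filter_ex (Fn n).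
  have /asboolP/(_ n)[k Hk] := valP x.
  by exists k => j jn; rewrite Hx // Hk.
exists (exist _ b bP); split=> // A /hull_nbhsP[n Hn].
by apply: filterS (Fn n) => x; exact: Hn.
Qed.

Lemma hull_shift_subproof (x : hull R f) : `[< factors_in f (fun k => val x k.+1) >].
Proof.
apply/asboolP => n; have /asboolP/(_ n.+1)[k Hk] := valP x.
by exists k.+1 => j jn; rewrite Hk // addSnnS.
Qed.
Definition hull_shift (x : hull R f) : hull R f := exist (fun y => `[< factors_in f y >]) _ (hull_shift_subproof x).

Lemma iter_hull_shift t x k : val (iter t hull_shift x) k = val x (k + t)%N.
Proof. by elim: t k => [|t IH] k /=; rewrite ?addn0 // IH addSnnS. Qed.

Lemma continuous_hull_shift : continuous hull_shift.
Proof.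
move=> x A /hull_nbhsP[n Hn]; apply/nbhs_ballP.
exists n.+1%:R^-1; first by rewrite /= invr_gt0.
move=> y [_ Hy]; apply: Hn => k kn /=; apply: Hy.
by rewrite mulrC ler_pdivrMr ?ltr0n // mul1r ler_nat.
Qed.

Lemma continuous_hull_head : continuous (fun x : hull R f => (val x 0%N)%:R : R).
Proof.
move=> x A /nbhs_singleton Ax; apply/nbhs_ballP.
exists 1 => //= y [_ Hy]; rewrite /= -Hy // mulr1 //.
Qed.

Lemma hull_base_subproof : `[< factors_in f f >].
Proof. by apply/asboolP => n; exists 0%N. Qed.
Definition hull_base : hull R f := exist (fun y => `[< factors_in f y >]) _ hull_base_subproof.

Lemma hull_zero_entropy : low_complexity R f -> zero_entropy hull_shift.
Proof.
move=> Hf eps eps0 d d0.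
(* Being within eps depends on at most the first K coordinates, so separated points have distinct
   prefixes of length n + K, and these are factors of f. *)
pose K := (Num.truncn eps^-1).+1.
have [N0 HN0] := factor_count Hf K d0; exists N0 => n Nn m s Hs.
pose w i := mkseq (val (s i)) (n + K).
have winj : injective w.
  move=> i j wij; apply/eqP; apply: contrapT => /negP /(Hs i j)[t tn]; apply; split=> // k Hk.
  rewrite !iter_hull_shift.
  have kK : (k < K)%N.
    rewrite -(ltr_nat R) (lt_le_trans (_ : _ < k.+1%:R)) ?ltr_nat //.
    apply: (@le_trans _ _ eps^-1); first by rewrite -ler_pdivlMl // mulr1 in Hk.
    by rewrite ltW // truncnS_gt.
  have ktn : (k + t < n + K)%N by lia.
  have := congr1 (fun u => nth false u (k + t)) wij.
  by rewrite !nth_mkseq.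
have := HN0 n Nn (codom w).
rewrite size_codom card_ord; apply; first by apply/injectiveP.
move=> u /codomP[i ->]; have /asboolP/(_ (n + K)%N)[k Hk] := valP (s i).
exists k; apply/eq_in_map => j; rewrite mem_iota => /andP[_ jn]; exact: Hk.
Qed.

Theorem sarnak_low_complexity : sarnak R -> low_complexity R f ->
  avg (fun n => (f n)%:R * (moebius n)%:~R) @ \oo --> (0 : R).
Proof.
move=> HS Hf.
have c0 : continuous (fun _ : hull R f => 0 : R) by move=> x A /nbhs_singleton A0; exact: (@filterE _ (nbhs x)).
have [H _] := HS (hull R f) hull_hausdorff hull_compact hull_shift continuous_hull_shift
  (hull_zero_entropy Hf) hull_base _ _ continuous_hull_head c0.
suff -> : (fun n => (f n)%:R * (moebius n)%:~R) =
  (fun n => (val (iter n hull_shift hull_base) 0%N)%:R * (moebius n)%:~R) :> (nat -> R) by [].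
by apply/funext => n; rewrite iter_hull_shift.
Qed.

End Hull.

(** * Orthogonality of mu to the far future *)

Lemma future_op (V T1 T2 T3 : Type) (v : nat -> V) w (op : T1 -> T2 -> T3)
    (f : nat -> T1) (g : nat -> T2) :
  future v w f -> future v w g -> future v w (fun n => op (f n) (g n)).
Proof.
move=> [M1 [q1 [q10 H1]]] [M2 [q2 [q20 H2]]].
exists (maxn M1 M2), (q1 * q2)%N; split=> [|n n' Hn Hv]; first by rewrite muln_gt0 q10.
rewrite (H1 n n') ?(H2 n n') //.
- by rewrite -(modn_dvdm n (dvdn_mull q1 (dvdnn q2))) Hn modn_dvdm // dvdn_mull.
- by move=> j /andP[wj jM]; apply: Hv; rewrite wj leq_max jM orbT.
- by rewrite -(modn_dvdm n (dvdn_mulr q2 (dvdnn q1))) Hn modn_dvdm // dvdn_mulr.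
- by move=> j /andP[wj jM]; apply: Hv; rewrite wj leq_max jM.
Qed.

Section Extremal.
Context {R : realType} (E : (nat -> R) -> R) (HE : logmean E).
Context (V : Type) (v : nat -> V) (g : nat -> R).
Context (Hg : forall n, `|g n| <= 1).

Let corr (A : nat -> bool) : R := E (fun n => (A n)%:R * g n).
Let size_of (A : nat -> bool) : R := E (fun n => (A n)%:R).

Let bg : bdd g. Proof. by exists 1. Qed.
Let bAg A : bdd (fun n => (A n : bool)%:R * g n). Proof. exact: bddM. Qed.

Lemma corr_le1 A : corr A <= 1.
Proof.
rewrite -[leRHS](lm_cst HE); apply: (lm_mono HE) => // n.
by case: (A n); rewrite ?mul1r ?mul0r // (le_trans (ler_norm _)).
Qed.

Lemma corr_modular A B :
  corr (fun n => A n && B n) + corr (fun n => A n || B n) = corr A + corr B.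
Proof.
rewrite /corr -!(lmD HE) //; apply: eq_lm => n.
by case: (A n); case: (B n); rewrite /= ?mul1r ?mul0r ?addr0 ?add0r.
Qed.

Lemma size_of_ge0 A : 0 <= size_of A.
Proof. exact: (lm_ge0 HE). Qed.

Lemma size_of_le1 A : size_of A <= 1.
Proof.
rewrite -[leRHS](lm_cst HE); apply: (lm_mono HE) => // n; by rewrite lern1 leq_b1.
Qed.

(* Among the nearly optimal predictors from the future of w, take one of nearly
   minimal density.  By modularity of corr, the intersection of two of them is
   again nearly optimal, so minimality makes their symmetric difference small. *)
Theorem cauchy_predictors (c : R) : 0 < c ->
  (forall w, exists2 A, future v w A & c < corr A) ->
  exists alpha : nat -> nat -> bool, [/\ forall i, future v i (alpha i),
    forall e : R, 0 < e -> exists k, forall i, (k <= i)%N ->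
      E (fun n => (alpha i n != alpha k n)%:R) <= e &
    forall i, c / 2 <= corr (alpha i)].
Proof.
move=> c0 Hc.
pose VV w := sup [set corr A | A in [set A | future v w A]].
have VVub w A : future v w A -> corr A <= VV w.
  move=> fA; apply: ub_le_sup; last by exists A.
  by exists 1 => _ [B _ <-]; exact: corr_le1.
have VVc w : c <= VV w.
  by have [A fA cA] := Hc w; rewrite (le_trans (ltW cA)) // VVub.
pose L := inf [set VV w | w in setT].
have hiL : has_inf [set VV w | w in setT].
  by split; [exists (VV 0%N); exists 0%N|exists c => _ [w _ <-]].
have LV w : L <= VV w by apply: ge_inf; [case: hiL|exists w].
have Lc : c <= L by apply: lb_le_inf; [case: hiL|move=> _ [w _ <-]].
have VVmono w w' : (w <= w')%N -> VV w' <= VV w.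
  move=> ww; apply: ge_sup; first by have [A fA _] := Hc w'; exists (corr A), A.
  by move=> _ [A fA <-]; apply: VVub; exact: future_le fA.
have Llim (s : R) : 0 < s -> exists w0, forall w, (w0 <= w)%N -> VV w <= L + s.
  move=> s0; have [_ [w0 _ <-] H] := inf_adherent s0 hiL.
  by exists w0 => w /VVmono H'; rewrite (le_trans H') // ltW.
pose near w (s : R) := [set A | future v w A /\ L - s <= corr A].
have near0 w s : 0 < s -> exists A, near w s A.
  move=> s0; have hs : has_sup [set corr A | A in [set A | future v w A]].
    split; first by have [A fA _] := Hc w; exists (corr A), A.
    by exists 1 => _ [B _ <-]; exact: corr_le1.
  have [_ [A fA <-] HA] := sup_adherent s0 hs.
  exists A; split=> //; rewrite (le_trans _ (ltW HA)) // lerD2r; exact: LV.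
(* [nu] grows with w and as s shrinks, since there are fewer candidates; its supremum N is the
   limiting minimal density. *)
pose nu w s := inf [set size_of A | A in near w s].
have hinu w s : 0 < s -> has_inf [set size_of A | A in near w s].
  move=> s0; split; first by have [A hA] := near0 w s s0; exists (size_of A), A.
  by exists 0 => _ [A _ <-]; exact: size_of_ge0.
have nu_le w s A : near w s A -> nu w s <= size_of A.
  move=> hA; apply: ge_inf; last by exists A.
  by exists 0 => _ [B _ <-]; exact: size_of_ge0.
have nu_mono w s w' s' : (w <= w')%N -> s' <= s -> 0 < s' -> nu w s <= nu w' s'.
  move=> ww ss s0; apply: lb_le_inf; first by case: (hinu w' s' s0).
  move=> _ [A [fA cA] <-]; apply: nu_le; split; first exact: future_le fA.
  by rewrite (le_trans _ cA) // lerD2l lerN2.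
pose N := sup [set nu ws.1 ws.2 | ws in [set ws : nat * R | 0 < ws.2]].
have hsN : has_sup [set nu ws.1 ws.2 | ws in [set ws : nat * R | 0 < ws.2]].
  split; first by exists (nu 0%N 1), (0%N, 1) => //=.
  exists 1 => _ [[w s] /= s0 <-]; have [A hA] := near0 w s s0.
  by rewrite (le_trans (nu_le _ _ _ hA)) // size_of_le1.
have nuN w s : 0 < s -> nu w s <= N.
  by move=> s0; apply: ub_le_sup; [case: hsN|exists (w, s)].
pose s i : R := i.+1%:R^-1.
have s0 i : 0 < s i by rewrite /s invr_gt0.
have slim (d : R) : 0 < d -> exists k, forall i, (k <= i)%N -> s i <= d.
  move=> d0; exists (Num.truncn d^-1) => i ki.
  rewrite /s -[leRHS]invrK lef_pV2 ?posrE ?invr_gt0 //.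
  by rewrite (le_trans (ltW (truncnS_gt _))) // ler_nat.
have /choice[A HA] : forall i, exists A, near i (s i) A /\ size_of A < nu i (s i) + s i.
  move=> i; have [_ [A hA <-] HA] := inf_adherent (s0 i) (hinu i (s i) (s0 i)).
  by exists A.
have [i1 Hi1] := slim (c / 2) (divr_gt0 c0 (ltr0Sn R 1)).
exists (fun i => A (i + i1)%N); split.
- by move=> i; have [[fA _] _] := HA (i + i1)%N; apply: future_le fA; exact: leq_addr.
(* Two densities at most N + e / 4 and an intersection of density at least N - e / 4 leave a
   symmetric difference of at most 4 (e / 4). *)
- move=> e e0; have e4 : 0 < e / 4 by lra.
  have [_ [[w1 t] /= t0 <-] Hnu] := sup_adherent e4 hsN.
  (* By modularity an intersection correlates at least 2 (L - t / 3) - (L + t / 3) = L - t, so it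
     competes in the infimum [nu w0 t]. *)
  have t3 : 0 < t / 3 by lra.
  have [w2 Hw2] := Llim (t / 3) t3.
  have [k1 Hk1] := slim (t / 3) t3; have [k2 Hk2] := slim (e / 4) e4.
  pose w0 := maxn w1 w2; pose k := maxn w0 (maxn k1 k2).
  have meas i : (k <= i)%N -> [/\ future v w0 (A i), L - t / 3 <= corr (A i) & size_of (A i) <= N + e / 4].
    move=> ki; have [[fA cA] mA] := HA i; split.
    - by apply: future_le fA; rewrite (leq_trans _ ki) // leq_maxl.
    - rewrite (le_trans _ cA) // lerD2l lerN2 Hk1 // (leq_trans _ ki) //.
      by rewrite /k !leq_max leqnn orbT.
    - rewrite (le_trans (ltW mA)) // lerD ?nuN // Hk2 // (leq_trans _ ki) //.
      by rewrite /k !leq_max leqnn !orbT.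
  have nuw0 : N - e / 4 <= nu w0 t.
    by rewrite (le_trans (ltW Hnu)) // nu_mono // leq_maxl.
  have inter i j : (k <= i)%N -> (k <= j)%N -> N - e / 4 <= size_of (fun n => A i n && A j n).
    move=> ki kj; rewrite (le_trans nuw0) //; apply: nu_le.
    have [f1 c1 _] := meas i ki; have [f2 c2 _] := meas j kj.
    split; first exact: future_op.
    have fU : future v w0 (fun n => A i n || A j n) by exact: future_op.
    have := VVub _ _ fU; have := Hw2 w0 (leq_maxr _ _); have := corr_modular (A i) (A j).
    move: c1 c2; lra.
  exists k => i ki; have ki1 : (k <= i + i1)%N by rewrite (leq_trans ki) // leq_addr.
  have kk : (k <= k + i1)%N by exact: leq_addr.
  have h := inter _ _ ki1 kk.
  have [_ _ m1] := meas _ ki1; have [_ _ m2] := meas _ kk.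
  have : E (fun n => (A (i + i1)%N n != A (k + i1)%N n)%:R)
      + 2 * size_of (fun n => A (i + i1)%N n && A (k + i1)%N n)
    = size_of (A (i + i1)%N) + size_of (A (k + i1)%N).
    rewrite /size_of -(lmZ HE) // -!(lmD HE) //; last exact: bddM.
    by apply: eq_lm => n; case: (A _ n); case: (A _ n) => /=; lra.
  move: h m1 m2; lra.
move=> i; have [[_ cA] _] := HA (i + i1)%N; rewrite -/(corr _) (le_trans _ cA) //.
have := Hi1 (i + i1)%N (leq_addl _ _); lra.
Qed.
End Extremal.

Section Veech.
Context {R : realType} (HS : sarnak R) (E : (nat -> R) -> R) (HE : logmean E).

Definition mu n : R := (moebius n)%:~R.
(** The value of mu in a finite type, as the entropy of windows requires. *)
Definition mucode n : bool * bool := (moebius n == 1, moebius n == -1).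

Lemma moebius_cases n : [\/ moebius n = 0, moebius n = 1 | moebius n = -1].
Proof.
rewrite /moebius; case: ifP => _; last by constructor 1.
by rewrite -signr_odd; case: (odd _); [constructor 3|constructor 2].
Qed.

Lemma mucodeP n n' : mucode n = mucode n' <-> moebius n = moebius n'.
Proof.
rewrite /mucode; split=> [|->//].
by case: (moebius_cases n) => ->; case: (moebius_cases n') => ->.
Qed.

Lemma norm_mu_le1 n : `|mu n| <= 1.
Proof.
rewrite /mu; case: (moebius_cases n) => ->; rewrite ?normr0 ?rmorph1 ?normr1 //.
by rewrite rmorphN1 normrN1.
Qed.

(** If the averages were at least c infinitely often, a mean living on those N would contradict the
    Cesaro statement, which forces every logarithmic mean to vanish. *)
Lemma low_complexity_orth f (c : R) : low_complexity R f -> 0 < c ->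
  exists N0, forall N, (N0 <= N)%N -> lavg (fun n => (f n)%:R * mu n) N < c.
Proof.
move=> Hf c0; apply: contrapT => /forallNP H.
have [|E' HE' Hc] := @logmean_along R [set N | c <= lavg (fun n => (f n)%:R * mu n) N].
  move=> N0; have /existsNP[N /not_implyP[h1 /negP h2]] := H N0.
  by exists N => //; rewrite /= leNgt.
have b : bdd (fun n => (f n)%:R * mu n) by apply: bddM => //; exact: bdd_moebius.
have := Hc _ c b (fun N h => h).
by rewrite (lm_avg0 HE' b (sarnak_low_complexity HS Hf)) leNgt c0.
Qed.

(* Ergodically: mu is orthogonal to the Pinsker factor of its Furstenberg
   systems. *)
Theorem future_orth (c : R) : 0 < c ->
  exists w, forall A : nat -> bool, future mucode w A -> E (fun n => (A n)%:R * mu n) <= c.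
Proof.
move=> c0; apply: contrapT => /forallNP H.
have [w|alpha [Hfut Hcau Hc]] := @cauchy_predictors R E HE _ mucode mu norm_mu_le1 c c0.
  have /existsNP[A /not_implyP[h1 /negP h2]] := H w.
  by exists A => //; rewrite ltNge.
have c2 : 0 < c / 2 by lra.
have c8 : 0 < c / 2 / 4 by lra.
have [f fL Hf] := glue HE norm_mu_le1 Hfut Hcau c2 Hc.
have [N0 HN0] := low_complexity_orth fL c8.
have [N h1 h2] := Hf N0.
by have := HN0 N h1; rewrite ltNge h2.
Qed.

End Veech.

(** * Chowla's conjecture for logarithmic means *)

Lemma card_smooth w t : (\sum_(1 <= n < (2 ^ t).+1) all (fun p => p <= w)%N (primes n) <= t.+1 ^ w.+1)%N.
Proof.
rewrite -big_mkcond /= sum1_count -size_filter.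
set s := [seq n <- _ | _].
pose F n : {ffun 'I_w.+1 -> 'I_t.+1} := [ffun p : 'I_w.+1 => inord (logn p n)].
have logt n p : n \in s -> (logn p n <= t)%N.
  rewrite mem_filter mem_index_iota ltnS => /and3P[_ n0 nt].
  case: (boolP (prime p)) => [pp|/negbTE pN]; last by rewrite /logn pN.
  rewrite -(leq_exp2l _ _ (ltnSn 1)) (leq_trans _ nt) //.
  apply: leq_trans (_ : (p ^ logn p n <= _)%N); last by rewrite dvdn_leq // pfactor_dvdnn.
  by case: (logn p n) => // k; rewrite leq_exp2r // prime_gt1.
have -> : (t.+1 ^ w.+1 = #|{ffun 'I_w.+1 -> 'I_t.+1}|)%N by rewrite card_ffun !card_ord.
have inj : {in s &, injective F}.
  move=> n n' ns n's H; move: (ns) (n's); rewrite !mem_filter !mem_index_iota.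
  move=> /and3P[/allP sn n0 _] /and3P[/allP sn' n0' _].
  apply: eqn_from_log => // p.
  have [pw|wp] := leqP p w.
    have := congr1 (fun f : {ffun 'I_w.+1 -> 'I_t.+1} => val (f (Ordinal (pw : (p < w.+1)%N)))) H.
    by rewrite !ffunE /= !inordK ?ltnS ?logt.
  have Z k : {in primes k, forall x, (x <= w)%N} -> logn p k = 0%N.
    move=> Hk; apply/eqP; rewrite -leqn0 leqNgt logn_gt0; apply/negP => /Hk.
    by rewrite leqNgt wp.
  by rewrite !Z.
rewrite -(size_map F) cardE; apply: uniq_leq_size.
  by rewrite map_inj_in_uniq // filter_uniq // iota_uniq.
by move=> f _; rewrite mem_enum.
Qed.

Lemma sq_le_exp2 u : (4 <= u)%N -> (u * u <= 2 ^ u)%N.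
Proof.
elim: u => // u IH; rewrite leq_eqVlt => /orP[/eqP<- //|]; rewrite ltnS => u4.
rewrite expnS mul2n -addnn; have := IH u4; nia.
Qed.

(* At least half of the integers up to 2 ^ t have a prime factor p > w, because
   those without are determined by w + 1 exponents, each at most t. *)
Lemma prime_harmonic (R : realFieldType) w : exists P : seq nat,
  [/\ uniq P, {in P, forall p, prime p && (w < p)%N} & 2^-1 <= \sum_(p <- P) p%:R^-1 :> R].
Proof.
(* With t + 1 = 2^u, the smooth bound 2 (t + 1)^(w + 1) <= 2^t becomes u (w + 1) + 1 <= 2^u - 1,
   which u^2 <= 2^u provides. *)
pose u := (w + 5)%N; pose t := (2 ^ u).-1; pose N := (2 ^ t)%N.
pose P := [seq p <- index_iota 0 N.+1 | prime p && (w < p)%N].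
have tE : t.+1 = (2 ^ u)%N by rewrite prednK // expn_gt0.
have smooth : (2 * t.+1 ^ w.+1 <= N)%N.
  rewrite tE -expnM -expnS leq_exp2l //.
  have := @sq_le_exp2 u; rewrite -tE /u; nia.
exists P; split.
- by rewrite filter_uniq // iota_uniq.
- by move=> p; rewrite mem_filter => /andP[].
have Npos : (0 < N)%N by rewrite expn_gt0.
have count : (N <= t.+1 ^ w.+1 + \sum_(p <- P) N %/ p)%N.
  have -> : N = (\sum_(1 <= n < N.+1) 1)%N by rewrite sum_nat_const_nat subn1 muln1.
  apply: leq_trans (_ : \sum_(1 <= n < N.+1) (all (fun p => p <= w)%N (primes n) + \sum_(p <- P) (p %| n)) <= _)%N.
    rewrite big_nat [leqRHS]big_nat; apply: leq_sum => n /andP[n0 nN].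
    have [//|/allPn[p pn]] := boolP (all _ _); rewrite -ltnNge => wp.
    rewrite add0n (bigD1_seq p) /=; last by rewrite filter_uniq // iota_uniq.
      by move: pn; rewrite mem_primes => /and3P[_ _ ->].
    move: pn; rewrite mem_primes => /and3P[pp _ dv].
    by rewrite mem_filter pp wp mem_index_iota /= (leq_ltn_trans (dvdn_leq n0 dv)).
  rewrite big_split /= leq_add ?card_smooth // exchange_big /= {1}sum_nat_const_nat subn1 muln1.
  by apply: leq_sum => p _; rewrite divn_count_dvd.
have NR : 0 < N%:R :> R by rewrite ltr0n.
have h1 : N%:R <= t.+1%:R ^+ w.+1 + N%:R * \sum_(p <- P) p%:R^-1 :> R.
  apply: (@le_trans _ _ (t.+1 ^ w.+1 + \sum_(p <- P) N %/ p)%:R); first by rewrite ler_nat.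
  rewrite natrD natrX lerD2l natr_sum mulr_sumr big_seq [leRHS]big_seq.
  apply: ler_sum => p; rewrite mem_filter => /andP[/andP[pp _] _].
  by rewrite ler_pdivlMr ?ltr0n ?prime_gt0 // -natrM ler_nat leq_divM.
have h2 : 2 * t.+1%:R ^+ w.+1 <= N%:R :> R by rewrite -natrX -natrM ler_nat.
rewrite -(ler_pM2l NR); lra.
Qed.

Lemma moebius_primeM p m : prime p -> ~~ (p %| m)%N -> moebius (p * m) = - moebius m.
Proof.
move=> pp pm; have m0 : (0 < m)%N by case: m pm => //; rewrite dvdn0.
have p0 := prime_gt0 pp.
have P : perm_eq (primes (p * m)) (p :: primes m).
  apply: uniq_perm; rewrite /= ?primes_uniq ?andbT //.
    by rewrite mem_primes pp m0.
  by move=> r; rewrite primesM // primes_prime // mem_seq1 inE.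
rewrite /moebius muln_gt0 p0 m0 /= (perm_size P) (perm_all _ P) /= lognM // logn_prime // eqxx.
have -> : logn p m = 0%N by rewrite lognE (negbTE pm) !andbF.
have -> : all (fun r => logn r (p * m) <= 1)%N (primes m) = all (fun r => logn r m <= 1)%N (primes m).
  apply: eq_in_all => r rm; rewrite lognM // logn_prime //.
  by case: eqP => // rp; move: rm; rewrite mem_primes rp (negbTE pm) !andbF.
by case: (all _ _); rewrite ?oppr0 //= exprS mulN1r.
Qed.

(** * From future events to functions with bounded second moment *)

Section OrthL2.
Context {R : realType} (E : (nat -> R) -> R) (HE : logmean E).
Context (V : finType) (v : nat -> V) (g : nat -> R).
Context (Hg : forall n, `|g n| <= 1).
Context (Eg : E g = 0).

(** [Phi] is cut at height B: below it, correlation with events suffices; above it, |y| <= y^2 / B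
    hands the loss to the second moment. *)
Lemma orth_l2 (w : nat) (e B : R) (Phi : nat -> R) :
  (forall A : nat -> bool, future v w A -> E (fun n => (A n)%:R * g n) <= e) ->
  future v w Phi -> bdd Phi -> 0 < B ->
  `|E (fun n => Phi n * g n)| <= 2 * B * e + E (fun n => Phi n ^+ 2) / B.
Proof.
move=> HA [M [q [q0 HPhi]]] bPhi B0.
have bg : bdd g by exists 1.
pose xi n := (res q.-1 n, win v M (n + w)).
have xiP n n' : xi n = xi n' -> Phi n = Phi n'.
  move=> [/res_eq]; rewrite prednK // => Hq /win_eq Hw; apply: HPhi => // j /andP[wj jM].
  have := Hw (j - w)%N; rewrite -!addnA subnKC //; apply; lia.
have fxi (h : _ -> bool) : future v w (fun n => h (xi n)).
  exists (w + M)%N, q; split=> // n n' Hq Hv.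
  suff -> : xi n = xi n' by [].
  congr pair; first by apply/res_eq; rewrite prednK.
  apply/win_eq => j jM; rewrite -!addnA; apply: Hv; lia.
have /choice[y Hy] : forall a, exists y, forall n, xi n = a -> Phi n = y.
  move=> a; have [[n Hn]|H] := pselect (exists n, xi n = a).
    by exists (Phi n) => n' Hn'; apply: xiP; rewrite Hn.
  by exists 0 => n Hn; exfalso; apply: H; exists n.
pose b a : R := E (fun n => (xi n == a)%:R * g n).
have bxi a : bdd (fun n => (xi n == a)%:R * g n) by exact: bddM.
have decomp (F : nat -> R) n : F n = \sum_a (xi n == a)%:R * F n.
  rewrite (bigD1 (xi n)) //= eqxx mul1r big1 ?addr0 // => a.
  by rewrite eq_sym => /negbTE ->; rewrite mul0r.
have b_le a : `|b a| <= law E xi a.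
  apply: le_trans (lm_norm HE (bxi a)) _; apply: (lm_mono HE) => //; first exact: bdd_norm.
  by move=> n; case: eqP => _; rewrite ?mul1r ?mul0r ?normr0.
have E1 : E (fun n => Phi n * g n) = \sum_a y a * b a.
  transitivity (E (fun n => \sum_a y a * ((xi n == a)%:R * g n))); last first.
    rewrite (lm_sum HE); last by move=> a; exact: bddM.
    by apply: eq_bigr => a _; rewrite (lmZ HE).
  apply: eq_lm => n; rewrite (decomp (fun n => Phi n * g n)); apply: eq_bigr => a _.
  by case: eqP => [/Hy ->|]; rewrite ?mul1r ?mul0r ?mulr0.
have E2 : E (fun n => Phi n ^+ 2) = \sum_a y a ^+ 2 * law E xi a.
  transitivity (E (fun n => \sum_a y a ^+ 2 * (xi n == a)%:R)); last first.
    rewrite (lm_sum HE); last by move=> a; apply: bddM => //; exact: bdd_bool.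
    by apply: eq_bigr => a _; rewrite (lmZ HE) //; exact: bdd_bool.
  apply: eq_lm => n; rewrite (decomp (fun n => Phi n ^+ 2)); apply: eq_bigr => a _.
  by case: eqP => [/Hy ->|]; rewrite ?mul1r ?mulr1 ?mul0r ?mulr0.
have sel (P : pred _) : E (fun n => (P (xi n))%:R * g n) = \sum_(a | P a) b a.
  rewrite -(lm_sum HE) //; apply: eq_lm => n; rewrite big_mkcond /=.
  rewrite (decomp (fun n => (P (xi n))%:R * g n)); apply: eq_bigr => a _.
  case: eqP => [<-|_]; first by rewrite mul1r; case: (P _); rewrite ?mul1r ?mul0r.
  by rewrite !mul0r; case: (P a).
(* The b a sum to E g = 0, so their absolute values sum to twice the positive part, which is the
   correlation of g with a single future event. *)
have S1 : \sum_a `|b a| <= 2 * e.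
  pose P a := 0 <= b a.
  have h1 := HA _ (fxi P); rewrite sel in h1.
  have h2 := HA _ (fxi (fun a => ~~ P a)).
  have h0 : \sum_a b a = 0.
    transitivity (E (fun n => (predT (xi n))%:R * g n)); first by rewrite sel.
    by rewrite -Eg; apply: eq_lm => n; rewrite mul1r.
  have h3 := h0; rewrite (bigID P) /= in h3.
  rewrite (bigID P) /= [X in X + _](eq_bigr b); last by move=> a Pa; rewrite ger0_norm.
  rewrite [X in _ + X](eq_bigr (fun a => - b a)); last first.
    by move=> a; rewrite /P -ltNge => /ltW Pa; rewrite ler0_norm.
  rewrite sumrN; lra.
rewrite E1 E2 (le_trans (ler_norm_sum _ _ _)) //.
apply: (@le_trans _ _ (\sum_a (B * `|b a| + y a ^+ 2 * law E xi a / B))).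
  apply: ler_sum => a _; rewrite normrM.
  have b0 := normr_ge0 (b a); have y0 := normr_ge0 (y a).
  have [yB|By] := leP `|y a| B.
    rewrite (le_trans (ler_wpM2r b0 yB)) // lerDl divr_ge0 ?(ltW B0) // mulr_ge0 ?sqr_ge0 //.
    exact: law_ge0.
  rewrite (le_trans (_ : _ <= y a ^+ 2 * law E xi a / B)) //; last first.
    by rewrite lerDr mulr_ge0 // ltW.
  rewrite ler_pdivlMr // -(real_normK (num_real (y a))) expr2.
  rewrite -mulrA -[leRHS]mulrA; apply: ler_wpM2l => //.
  by rewrite mulrC ler_pM // ltW.
rewrite big_split /= -mulr_suml lerD2r -mulr_sumr mulrAC [2 * e * B]mulrC.
by rewrite ler_pM2l.
Qed.

End OrthL2.

(** * Patterns with a periodic weight *)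

Section ChowlaPeriodic.
Context {R : realType} (HS : sarnak R) (E : (nat -> R) -> R) (HE : logmean E).

Lemma lm_dvdn p k : (0 < p)%N -> E (fun n => (p %| n + k)%N%:R) = p%:R^-1.
Proof.
move=> p0; rewrite (lm_shift HE k (g := fun n => (p %| n)%N%:R)) //.
rewrite -[RHS]mulr1 -[X in _ = _ * X](lm_cst HE) -(lm_dil HE) //.
by apply: eq_lm => n; rewrite mulr1.
Qed.

(** The constant sequence has low complexity, so Sarnak's hypothesis already contains this form of
    the prime number theorem. *)
Lemma lm_mu : E mu = 0.
Proof.
have b : bdd (fun n => (true : nat)%:R * @mu R n) by apply: bddM => //; exact: bdd_moebius.
have lc : low_complexity R (fun=> true).
  move=> e e0; exists 1%N, [:: [:: true]], 0%N; split=> //.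
  by rewrite -[leLHS]expR0 ler_expR mulr1 ltW.
rewrite -(lm_avg0 HE b (sarnak_low_complexity HS lc)).
by apply: eq_lm => n; rewrite mul1r.
Qed.

(* A site occurring j times in s stands for the exponent j. *)
Definition mu_prod (s : seq nat) (n : nat) : R := \prod_(h <- s) mu (n + h).

Lemma mu_prod_le1 s n : `|mu_prod s n| <= 1.
Proof.
elim: s => [|h s IH]; first by rewrite /mu_prod big_nil normr1.
by rewrite /mu_prod big_cons normrM mulr_ile1 ?norm_mu_le1.
Qed.

Lemma mu_prod_dil p s m : prime p -> ~~ has (fun h => p %| m + h)%N s ->
  mu_prod s m = (-1) ^+ size s * mu_prod [seq (p * h)%N | h <- s] (p * m).
Proof.
move=> pp; elim: s => [|h s IH] /=; first by rewrite /mu_prod !big_nil mulr1.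
rewrite negb_or => /andP[ph /IH]; rewrite /mu_prod /= !big_cons => ->.
rewrite -mulnDr (_ : mu (p * (m + h)) = - mu (m + h)) ?exprS; first by ring.
by rewrite /mu moebius_primeM // rmorphN.
Qed.

Context (psi : nat -> R) (q : nat) (O : seq nat).
Context (q0 : (0 < q)%N) (Hper : forall n n', n = n' %[mod q] -> psi n = psi n').
Context (psi1 : forall n, `|psi n| <= 1) (O0 : all (fun o => 0 < o)%N O).

Let C n : R := psi n * mu_prod (0%N :: O) n.
Let K := size (0%N :: O).
Let phi p n : R := (p %| n)%N%:R * psi (n %/ p)%N * mu_prod [seq (p * o)%N | o <- O] n.

Let bpsi : bdd psi. Proof. by exists 1. Qed.
Let bprod s : bdd (mu_prod s). Proof. by exists 1 => n; exact: mu_prod_le1. Qed.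
Let bmu : bdd (@mu R). Proof. exact: bdd_moebius. Qed.
Let bC : bdd C. Proof. by apply: bddM. Qed.
Let bphi p : bdd (phi p).
Proof. by apply: bddM => //; apply: bddM => //; exact: bdd_comp. Qed.

(** The sign rule fails only when p divides some m + h. Each of the K sites does so with density 1 /
    p, the dilation contributes another 1 / p, and the error there is at most 2. *)
Lemma dilation_defect p : prime p ->
  `|p%:R^-1 * E C - (-1) ^+ K * E (fun n => phi p n * mu n)| <= 2 * K%:R / p%:R ^+ 2.
Proof.
move=> pp; have p0 := prime_gt0 pp.
have bphm : bdd (fun n => phi p n * mu n) by exact: bddM.
pose G m : R := \sum_(h <- 0%N :: O) 2 * (p %| m + h)%N%:R.
have bG : bdd G by apply: bdd_sum => h; apply: bddM => //; exact: bdd_bool.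
have bd g : bdd g -> bdd (fun n => (p %| n)%N%:R * g (n %/ p)%N : R).
  by move=> bg; apply: bddM => //; exact: bdd_comp.
rewrite -(lm_dil HE) // -(lmZ HE) // -(lmB HE); [|exact: bd|exact: bddM].
have EG : E (fun n => (p %| n)%N%:R * G (n %/ p)%N) = 2 * K%:R / p%:R ^+ 2.
  rewrite (lm_dil HE) // /G (lm_sum HE); last by move=> h; apply: bddM => //; exact: bdd_bool.
  rewrite (eq_bigr (fun=> 2 / p%:R)) => [|h _]; last first.
    by rewrite (lmZ HE) ?lm_dvdn //; exact: bdd_bool.
  rewrite big_const_seq count_predT -/K iter_addr addr0 -[_ *+ K]mulr_natr expr2 invfM; ring.
have bdiff : bdd (fun n => (p %| n)%N%:R * C (n %/ p)%N - (-1) ^+ K * (phi p n * mu n)).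
  by apply: bddD; [exact: bd|apply: bddN; exact: bddM].
rewrite -EG (le_trans (lm_norm HE bdiff)) //; apply: (lm_mono HE); [exact: bdd_norm|exact: bd|].
move=> n; rewrite /phi; have [/dvdnP[m ->]|pn] := boolP (p %| n)%N; last first.
  by rewrite !mul0r mulr0 subr0 normr0.
rewrite !mul1r mulnK // [(m * p)%N]mulnC.
have [hs|hs] := boolP (has (fun h => p %| m + h)%N (0%N :: O)).
  have := hs => /hasP[h hin ph].
  apply: (@le_trans _ _ 2); last first.
    rewrite /G (big_rem h) //= ph mulr1 lerDl; apply: sumr_ge0 => i _; exact: mulr_ge0.
  rewrite (le_trans (ler_normB _ _)) // -[leRHS]/(1 + 1) lerD // !normrM ?normrX ?normrN1 ?expr1n ?mul1r.
    by rewrite mulr_ile1 // mu_prod_le1.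
  by rewrite !mulr_ile1 ?mulr_ge0 // ?mu_prod_le1 ?norm_mu_le1.
rewrite {1}/C (mu_prod_dil pp hs) -/K /mu_prod /= big_cons muln0 addn0.
rewrite (_ : _ - _ = 0) ?normr0 ?sumr_ge0 //; last by ring.
Qed.

(** A site o > 0 is moved to p o >= p >= w, and the weight together with divisibility by p is
    periodic modulo p q. *)
Lemma future_phi w p : (w <= p)%N -> (0 < p)%N -> future mucode w (phi p).
Proof.
move=> wp p0; apply: (@future_op _ _ _ _ mucode w (fun a b => a * b)).
  exists 0%N, (p * q)%N; split=> [|n n' Hn _]; first by rewrite muln_gt0 p0.
  have dv : (p %| n)%N = (p %| n')%N.
    by rewrite /dvdn -(modn_dvdm n (dvdn_mulr q (dvdnn p))) Hn modn_dvdm // dvdn_mulr.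
  rewrite dv; have [pn'|] := boolP (p %| n')%N; last by rewrite !mul0r.
  rewrite !mul1r; apply: Hper; move: dv Hn; rewrite pn'.
  case/dvdnP: pn' => m' -> /dvdnP[m ->]; rewrite !mulnK // ![(_ * p)%N]mulnC -!muln_modr.
  by move/eqP; rewrite eqn_pmul2l // => /eqP.
move: O0; elim: O => [|o s IH] /=.
  by move=> _; rewrite /mu_prod; exists 0%N, 1%N; split=> // n n' _ _; rewrite !big_nil.
move=> /andP[op /IH Hs].
have -> : mu_prod ((p * o)%N :: [seq (p * o)%N | o <- s]) =
    (fun n => mu (n + p * o) * mu_prod [seq (p * o)%N | o <- s] n).
  by apply/funext => n; rewrite /mu_prod big_cons.
apply: (@future_op _ _ _ _ mucode w (fun a b => a * b)) Hs.
exists (p * o).+1, 1%N; split=> // n n' _ Hv; rewrite /mu; congr (_%:~R).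
apply/mucodeP; apply: Hv; rewrite ltnSn andbT (leq_trans wp) //.
exact: leq_pmulr.
Qed.

Lemma chowla_periodic : E C = 0.
Proof.
apply/eqP; rewrite -normr_eq0 eq_le normr_ge0 andbT.
apply/ler_addgt0Pr => d d0; rewrite add0r.
(* Three errors of d S / 3 each: the dilation defects, thanks to p > 6 K / d; the term 2 (B S) e;
   and the second moment over B S, where S^2 + S <= 3 S^2. The cut is at B S because [Phi] has size
   about S. *)
pose B : R := 9 / d; have B0 : 0 < B by rewrite divr_gt0.
pose e : R := d ^+ 2 / 54; have e0 : 0 < e by rewrite divr_gt0 // exprn_gt0.
have [w0 Hw0] := future_orth HS HE e0.
have [w1 Hw1] := exists_nat_gt (6 * K%:R / d).
pose w := maxn w0 w1.
have [P [uP HP PS]] := prime_harmonic R w.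
set S := \sum_(p <- P) p%:R^-1 in PS.
have S0 : 0 < S by rewrite (lt_le_trans _ PS) // invr_gt0.
pose Phi n : R := \sum_(p <- P) phi p n.
have bPhi : bdd Phi by exact: bdd_sum.
have fPhi : future mucode w Phi.
  rewrite /Phi; move: HP; elim: (P) => [|p s IH] Hs.
    by exists 0%N, 1%N; split=> // n n' _ _; rewrite !big_nil.
  have -> : (fun n => \sum_(p <- p :: s) phi p n) = (fun n => phi p n + \sum_(p <- s) phi p n).
    by apply/funext => n; rewrite big_cons.
  apply: (@future_op _ _ _ _ mucode w (fun a b => a + b)).
    have /andP[/prime_gt0 p0 wp] := Hs p (mem_head _ _).
    by apply: future_phi => //; exact: ltnW.
  by apply: IH => r rs; apply: Hs; rewrite inE rs orbT.
have orth := orth_l2 HE norm_mu_le1 lm_mu (w := w) (e := e)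
  (fun A fA => Hw0 A (future_le (leq_maxl w0 w1) fA)) fPhi bPhi (mulr_gt0 B0 S0).
(* Distinct primes p and r divide n together with density exactly 1 / (p r), which gives at most
   S^2; the diagonal gives S. *)
have sq : E (fun n => Phi n ^+ 2) <= S ^+ 2 + S.
  have phi_le p n : `|phi p n| <= (p %| n)%N%:R.
    rewrite /phi; case: (p %| n)%N; last by rewrite !mul0r normr0.
    by rewrite mul1r normrM mulr_ile1 ?mu_prod_le1.
  apply: (@le_trans _ _ (E (fun n => \sum_(p <- P) \sum_(r <- P) ((p %| n) && (r %| n))%N%:R))).
    apply: (lm_mono HE).
    - exact: bddX.
    - by apply: bdd_sum => p; apply: bdd_sum => r; apply: bdd_bool.
    move=> n; rewrite -(real_normK (num_real (Phi n))) expr2.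
    have h : `|Phi n| <= \sum_(p <- P) (p %| n)%N%:R.
      by rewrite (le_trans (ler_norm_sum _ _ _)) // ler_sum.
    rewrite (le_trans (ler_pM _ _ h h)) // mulr_suml; apply: ler_sum => p _.
    rewrite mulr_sumr; apply: ler_sum => r _.
    by case: (p %| n)%N; case: (r %| n)%N; rewrite /= ?mulr1 ?mulr0.
  rewrite (lm_sum HE); last by move=> p; apply: bdd_sum => r; apply: bdd_bool.
  rewrite expr2 {2 3}/S mulr_sumr -big_split /= big_seq [leRHS]big_seq.
  apply: ler_sum => p pP; rewrite (lm_sum HE); last by move=> r; apply: bdd_bool.
  have /andP[pp _] := HP p pP; have p0 := prime_gt0 pp.
  rewrite (bigD1_seq p) //= addrC lerD //; last first.
    rewrite -(lm_dvdn 0 p0); apply: (lm_mono HE) => // n; first by rewrite andbb addn0.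
  rewrite /S mulr_suml [leRHS](bigD1_seq p) //= -[leLHS]add0r lerD ?mulr_ge0 ?invr_ge0 //.
  rewrite big_seq_cond [leRHS]big_seq_cond; apply: ler_sum => r /andP[rP rp].
  have /andP[pr _] := HP r rP.
  rewrite -invfM -natrM -(lm_dvdn 0) ?muln_gt0 ?p0 ?prime_gt0 //.
  apply: (lm_mono HE) => // n; rewrite addn0 Gauss_dvd; first by rewrite andbC.
  by rewrite prime_coprime // dvdn_prime2.
have lin : `|S * E C - (-1) ^+ K * E (fun n => Phi n * mu n)| <= d / 3 * S.
  have -> : E (fun n => Phi n * mu n) = \sum_(p <- P) E (fun n => phi p n * mu n).
    rewrite -(lm_sum HE); last by move=> p; exact: bddM.
    by apply: eq_lm => n; rewrite mulr_suml.
  rewrite /S mulr_suml mulr_sumr -sumrB (le_trans (ler_norm_sum _ _ _)) //.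
  rewrite mulr_sumr big_seq [leRHS]big_seq; apply: ler_sum => p pP.
  have /andP[pp wp] := HP p pP; have p0 := prime_gt0 pp.
  rewrite (le_trans (dilation_defect pp)) //.
  have pR : 0 < p%:R :> R by rewrite ltr0n.
  rewrite expr2 invfM mulrA ler_pM2r ?invr_gt0 // ler_pdivrMr //.
  have : w1%:R <= p%:R :> R by rewrite ler_nat (leq_trans _ (ltnW wp)) // leq_maxr.
  have d3 : 0 <= d by rewrite ltW.
  move: Hw1; rewrite ltr_pdivrMr // => h1 h2.
  have := ler_wpM2r d3 h2; move: h1; move: (w1%:R * d) => x; lra.
have h1 : `|S * E C| <= d / 3 * S + (2 * (B * S) * e + E (fun n => Phi n ^+ 2) / (B * S)).
  have -> : S * E C = (S * E C - (-1) ^+ K * E (fun n => Phi n * mu n)) + (-1) ^+ K * E (fun n => Phi n * mu n).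
    by rewrite subrK.
  rewrite (le_trans (ler_normD _ _)) // lerD //.
  by rewrite normrM normrX normrN1 expr1n mul1r.
have h2 : E (fun n => Phi n ^+ 2) / (B * S) <= d / 3 * S.
  rewrite ler_pdivrMr; last exact: mulr_gt0.
  apply: (le_trans sq).
  have -> : d / 3 * S * (B * S) = 3 * (S * S) by rewrite /B; field; rewrite gt_eqF.
  have : 2^-1 * S <= S * S by rewrite ler_pM2r.
  rewrite expr2; move: (S * S) => x; lra.
have h3 : 2 * (B * S) * e = d / 3 * S by rewrite /B /e; field; rewrite gt_eqF.
rewrite normrM (gtr0_norm S0) h3 in h1.
rewrite -(ler_pM2l S0); move: h1 h2; rewrite [S * d]mulrC; move: (S * `|E C|) => x; lra.
Qed.

End ChowlaPeriodic.

(** * Sieving by squares, and patterns with an odd site *)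

Lemma moebius_eq0P n : (0 < n)%N ->
  reflect (exists2 d, (1 < d)%N & (d ^ 2 %| n)%N) (moebius n == 0).
Proof.
move=> n0; rewrite /moebius n0 /=; apply: (iffP idP).
  case: ifPn => [_|/allPn[p]]; first by rewrite signr_eq0.
  rewrite mem_primes -ltnNge => /and3P[pp _ _] lp _.
  by exists p; [exact: prime_gt1|rewrite pfactor_dvdn].
move=> [d d1 dn]; case: ifPn => // /allP H; exfalso.
have pp := pdiv_prime d1.
have pn : (pdiv d ^ 2 %| n)%N by rewrite (dvdn_trans _ dn) // dvdn_exp2r // pdiv_dvd.
have := H (pdiv d); rewrite mem_primes pp n0 (dvdn_trans _ pn) ?dvdn_exp // => /(_ isT).
by rewrite leqNgt; rewrite pfactor_dvdn // in pn; rewrite pn.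
Qed.

(** The divisors tested are d = 2, ..., y + 1. *)
Definition sieved y n := all (fun d => ~~ (d ^ 2 %| n)%N) (iota 2 y).

Lemma sieved_periodic y : exists2 q, (0 < q)%N &
  forall n n', n = n' %[mod q] -> sieved y n = sieved y n'.
Proof.
exists (\prod_(d <- iota 2 y) d ^ 2)%N.
  rewrite big_seq; apply: prodn_cond_gt0 => d; rewrite mem_iota => /andP[d2 _].
  by rewrite expn_gt0 (leq_trans _ d2).
move=> n n' Hn; apply: eq_in_all => d dy; congr (~~ _).
have dq : (d ^ 2 %| \prod_(d <- iota 2 y) d ^ 2)%N by rewrite (big_rem d) //= dvdn_mulr.
by rewrite /dvdn -(modn_dvdm n dq) Hn modn_dvdm.
Qed.

Section OddPatterns.
Context {R : realType} (HS : sarnak R) (E : (nat -> R) -> R) (HE : logmean E).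

(** A survivor with mu n = 0 is divisible by d^2 for some d >= y + 2, and the sum of 1 / d^2
    telescopes against 1 / (d - 1) - 1 / d. As [E] is only finitely additive, the sum over d is
    taken inside the averages at finite N. *)
Lemma sieve_error y : E (fun n => (sieved y n && (moebius n == 0))%:R) <= y.+1%:R^-1.
Proof.
apply: (lm_le HE (N0 := 1)) => [|N N0]; first exact: bdd_bool.
have h0 := @harm_gt0 R N N0.
rewrite /lavg mulrC ler_pdivrMr //.
apply: (@le_trans _ _ (\sum_(1 <= n < N.+1) \sum_(y.+2 <= d < N.+1) (d ^ 2 %| n)%N%:R / n%:R)).
  rewrite big_nat [leRHS]big_nat; apply: ler_sum => n /andP[n0 nN].
  case: (boolP (sieved y n)) => [/allP sv|_]; last by rewrite mul0r; apply: sumr_ge0 => d _; rewrite divr_ge0.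
  case: moebius_eq0P => // [[d d1 dn]|_]; last by rewrite mul0r; apply: sumr_ge0 => d _; rewrite divr_ge0.
  have dy : (y.+2 <= d)%N.
    rewrite leqNgt; apply/negP => lt; have := sv d; rewrite mem_iota d1 add2n lt dn.
    by move=> /(_ isT).
  have dN : (d < N.+1)%N.
    apply: leq_ltn_trans nN; apply: leq_trans (dvdn_leq n0 dn).
    by rewrite expnS expn1 leq_pmulr // (leq_trans _ d1).
  rewrite (bigD1_seq d) ?iota_uniq ?mem_index_iota ?dy ?dN //= dn lerDl.
  by apply: sumr_ge0 => i _; rewrite divr_ge0.
rewrite exchange_big /=.
have Hd d : (0 < d)%N -> \sum_(1 <= n < N.+1) (d ^ 2 %| n)%N%:R / n%:R <= (d%:R ^+ 2)^-1 * harm N :> R.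
  move=> d0; set D := (d ^ 2)%N; have D0 : (0 < D)%N by rewrite expn_gt0 d0.
  rewrite big_dvdn //; under eq_bigr do rewrite natrM invfM.
  rewrite -mulr_sumr -natrX ler_wpM2l ?invr_ge0 //.
  rewrite /harm [leRHS](@big_cat_nat _ _ _ (N %/ D).+1) //= ?ltnS ?leq_div //.
  by rewrite lerDl; apply: sumr_ge0 => i _; rewrite invr_ge0.
apply: (@le_trans _ _ (\sum_(y.+2 <= d < N.+1) (d%:R ^+ 2)^-1 * harm N)).
  rewrite big_nat [leRHS]big_nat; apply: ler_sum => d /andP[yd _]; apply: Hd.
  exact: leq_trans yd.
rewrite -mulr_suml ler_pM2r //.
have [yN|Ny] := leqP y.+2 N.+1; last by rewrite big_geq ?invr_ge0 // ltnW.
apply: (@le_trans _ _ (\sum_(y.+2 <= d < N.+1) (- d%:R^-1 - - d.-1%:R^-1))).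
  rewrite big_nat [leRHS]big_nat; apply: ler_sum => -[//|[//|d]] _ /=.
  have x0 : 0 < d.+1%:R :> R by rewrite ltr0n.
  rewrite -[d.+2%:R]natr1; move: (d.+1%:R) x0 => x x0.
  have -> : - (x + 1)^-1 - - x^-1 = ((x + 1) * x)^-1.
    by field; rewrite !gt_eqF //; lra.
  rewrite expr2 lef_pV2 ?posrE ?mulr_gt0 ?ler_pM2l; lra.
rewrite (GRing.telescope_sumr_eq (fun d : nat => - d.-1%:R^-1)) //=.
by rewrite opprK addrC gerDl oppr_le0 invr_ge0.
Qed.

Lemma mu_exp n k : (0 < k)%N ->
  (mu n : R) ^+ k = if odd k then mu n else (moebius n != 0)%:R.
Proof.
move=> k0; rewrite /mu; case: (moebius_cases n) => ->.
- by rewrite expr0n gtn_eqF // eqxx; case: odd.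
- by rewrite expr1n; case: odd.
- by rewrite rmorphN1 -signr_odd; case: odd.
Qed.

(* Sites below the smallest odd one only carry powers of mu ^ 2, which sieving by
   finitely many squares approximates by a periodic function. *)
Theorem odd_pattern (s : seq nat) (x : nat) : odd (count_mem x s) -> E (mu_prod s) = 0.
Proof.
move=> ox; have ex : exists x, odd (count_mem x s) by exists x.
case: (ex_minnP ex) => {ox ex}x ox xmin.
have bprod (t : seq nat) : bdd (@mu_prod R t) by exists 1 => n; exact: mu_prod_le1.
pose D := [seq h <- undup s | (h < x)%N].
pose O := [seq (h - x)%N | h <- s & (x < h)%N].
pose C n : R := mu_prod (0%N :: O) (n + x).
have facts n : mu_prod s n = (all (fun h => moebius (n + h) != 0) D)%:R * C n.
  rewrite /mu_prod (bigID (fun h => h < x)%N) /=; congr (_ * _).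
    rewrite -big_undup_iterop_count -big_filter -/D big_seq.
    transitivity (\prod_(h <- D | h \in D) (moebius (n + h) != 0)%:R : R).
      apply: eq_bigr => h; rewrite mem_filter mem_undup => /andP[hx hs].
      rewrite (_ : iterop _ _ _ _ = mu (n + h) ^+ count_mem h s) //.
      rewrite mu_exp -?has_count ?has_pred1 //.
      by case: ifP => // /xmin; rewrite leqNgt hx.
    rewrite -big_seq; elim: D => [|h D' IH]; first by rewrite big_nil.
    by rewrite big_cons IH /=; case: (moebius _ != 0); rewrite ?mul1r ?mul0r.
  rewrite /C /mu_prod big_cons addn0 (bigID (pred1 x)) /=; congr (_ * _).
    transitivity (\prod_(h <- s | h == x) mu (n + x) : R).
      rewrite [LHS](eq_bigl (pred1 x)) => [|h]; last first.
        by rewrite /=; case: eqP => [->|]; rewrite ?ltnn ?andbF.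
      by apply: eq_bigr => h /eqP ->.
    rewrite big_const_seq iter_mulr_1 mu_exp ?ox //.
    by rewrite -has_count; move: ox; rewrite has_count; case: (count _ _).
  rewrite /O big_map big_filter; apply: eq_big => h; first by case: ltngtP.
  by case: ltngtP => // xh _; rewrite -addnA subnKC // ltnW.
apply/eqP; rewrite -normr_eq0 eq_le normr_ge0 andbT.
apply/ler_addgt0Pr => d d0; rewrite add0r.
have [y Hy] := exists_nat_gt ((size D)%:R / d).
have [q q0 Hq] := sieved_periodic y.
pose psi n : R := (all (fun h => sieved y (n + h)) D)%:R.
have psi_per n n' : n = n' %[mod q] -> psi n = psi n'.
  move=> Hn; rewrite /psi; congr (nat_of_bool _)%:R; apply: eq_all => h.
  by apply: Hq; apply/eqP; rewrite eqn_modDr; apply/eqP.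
have psi_le1 n : `|psi n| <= 1 by rewrite ger0_norm // lern1 leq_b1.
have bC : bdd C by exists 1 => n; exact: mu_prod_le1.
have bpsi : bdd psi by exists 1.
have main : E (fun n => psi n * C n) = 0.
  (* Adding (q - 1) x shifts back by x modulo q, so the shift that moves the site x to 0 restores
     [psi]. *)
  pose psi' n := psi (n + q.-1 * x)%N.
  have H := @chowla_periodic R HS E HE psi' q O q0.
  rewrite -[RHS]H; first last.
  - by apply/allP => o /mapP[h]; rewrite mem_filter => /andP[xh _] ->; rewrite subn_gt0.
  - by move=> n; exact: psi_le1.
  - by move=> n n' Hn; apply: psi_per; apply/eqP; rewrite eqn_modDr; apply/eqP.
  rewrite -[RHS](lm_shift HE x).
    apply: eq_lm => n; rewrite /psi' /C; congr (_ * _); apply: psi_per.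
    by rewrite -addnA -mulSn prednK // addnC mulnC modnMDl.
  by apply: bddM => //; exact: (bdd_comp (fun n => n + q.-1 * x)%N).
pose er n : R := (sieved y n && (moebius n == 0))%:R.
have ber : bdd er by exact: bdd_bool.
have diff : `|E (fun n => mu_prod s n - psi n * C n)| <= (size D)%:R * y.+1%:R^-1.
  have bd : bdd (fun n => mu_prod s n - psi n * C n).
    by apply: bddD; [exact: bprod|apply: bddN; exact: bddM].
  rewrite (le_trans (lm_norm HE bd)) //.
  apply: (@le_trans _ _ (E (fun n => \sum_(h <- D) er (n + h)%N))).
    apply: (lm_mono0 HE); [exact: bdd_norm|by apply: bdd_sum => h; exact: (bdd_comp (fun n => n + h)%N)|].
    move=> n n0; rewrite facts -mulrBl normrM.
    apply: (@le_trans _ _ `|(all (fun h => moebius (n + h) != 0) D)%:R - psi n|).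
      by rewrite ler_piMr // mu_prod_le1.
    rewrite /psi /er; elim: (D) => [|h D' IH] /=; first by rewrite subrr normr0 big_nil.
    rewrite big_cons; have n1 : (0 < n + h)%N by rewrite addn_gt0 n0.
    have S0 : 0 <= \sum_(j <- D') (sieved y (n + j) && (moebius (n + j) == 0))%:R :> R.
      exact: sumr_ge0.
    case: (boolP (moebius (n + h) == 0)) => m0; rewrite /= ?andbT ?andbF ?add0r.
      case: (sieved y (n + h)) => /=; last by rewrite oppr0 normr0 add0r.
      rewrite normrN ger0_norm //; apply: (@le_trans _ _ 1); first by rewrite lern1 leq_b1.
      by rewrite lerDl.
    have -> : sieved y (n + h); last by [].
    apply/allP => d'; rewrite mem_iota => /andP[d1 _]; apply/negP => dn.
    by move/negP: m0; apply; apply/moebius_eq0P => //; exists d'.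
  rewrite (lm_sum HE); last by move=> h; exact: (bdd_comp (fun n => n + h)%N).
  rewrite (eq_bigr (fun=> E er)) => [|h _]; last by rewrite (lm_shift HE h).
  rewrite big_const_seq count_predT iter_addr addr0 -[leLHS]mulr_natl ler_wpM2l //.
  exact: sieve_error.
rewrite (lmB HE) // ?main ?subr0 in diff; last exact: bddM.
rewrite (le_trans diff) // ler_pdivrMr ?ltr0n //.
rewrite mulrC -ler_pdivrMr // (le_trans (ltW Hy)) // ler_nat //.
Qed.

End OddPatterns.

(** * From logarithmic means to a sequence of Cesaro averages *)

Section AvgSquare.
Context {R : realType}.

Lemma avg_sq_le (f : nat -> R) N : avg f N ^+ 2 <= avg (fun n => f n ^+ 2) N.
Proof.
case: N => [|N]; first by rewrite /avg invr0 !mul0r expr0n.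
set m := avg f N.+1; have N0 : 0 < N.+1%:R :> R by rewrite ltr0n.
have Sf : \sum_(1 <= n < N.+2) f n = N.+1%:R * m by rewrite /m /avg mulVKf // gt_eqF.
rewrite /avg ler_pdivlMl //.
have : 0 <= \sum_(1 <= n < N.+2) (f n - m) ^+ 2 by apply: sumr_ge0 => n _; exact: sqr_ge0.
have -> : \sum_(1 <= n < N.+2) (f n - m) ^+ 2 =
    \sum_(1 <= n < N.+2) f n ^+ 2 - 2 * m * (\sum_(1 <= n < N.+2) f n) + N.+1%:R * m ^+ 2.
  have -> : N.+1%:R * m ^+ 2 = \sum_(1 <= n < N.+2) m ^+ 2.
    by rewrite sumr_const_nat subn1 mulr_natl.
  rewrite mulr_sumr -sumrB.
  by rewrite -big_split /=; apply: eq_bigr => n _; ring.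
rewrite Sf; lra.
Qed.

Lemma avg_shift_le (g : nat -> R) h N : (forall n, `|g n| <= 1) ->
  `|avg (fun n => g (n + h)%N) N - avg g N| <= 2 * h%:R / N%:R.
Proof.
move=> Hg; elim: h => [|h IH].
  rewrite (_ : (fun n => g (n + 0)%N) = g) ?subrr ?normr0 ?mulr0 ?mul0r //.
  by apply/funext => n; rewrite addn0.
have -> : avg (fun n => g (n + h.+1)%N) N - avg g N =
  (avg (fun n => g (n + h.+1)%N) N - avg (fun n => g (n + h)%N) N) +
  (avg (fun n => g (n + h)%N) N - avg g N) by ring.
rewrite (le_trans (ler_normD _ _)) // -[h.+1%:R]nat1r mulrDr mulrDl lerD //.
rewrite /avg -mulrBr -sumrB (GRing.telescope_sumr_eq (fun n => g (n + h)%N)) //; last first.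
  by move=> n _; rewrite addSnnS.
rewrite normrM ger0_norm ?invr_ge0 // mulrC ler_wpM2r ?invr_ge0 // mulr1.
by rewrite (le_trans (ler_normB _ _)) // -[leRHS]/(1 + 1) lerD.
Qed.

Context (HS : sarnak R) (E : (nat -> R) -> R) (HE : logmean E).

Lemma mu_prod_shift s h n : @mu_prod R s (n + h) = mu_prod [seq (h + i)%N | i <- s] n.
Proof. by rewrite /mu_prod big_map; apply: eq_bigr => i _; rewrite addnA. Qed.

Lemma mu_prod_cat s1 s2 n : @mu_prod R (s1 ++ s2) n = mu_prod s1 n * mu_prod s2 n.
Proof. by rewrite /mu_prod big_cat. Qed.

Lemma count_shift s h x : count_mem (h + x)%N [seq (h + i)%N | i <- s] = count_mem x s.
Proof. by rewrite count_map; apply: eq_count => i /=; rewrite eqn_add2l. Qed.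

(* The largest odd site of the later copy lies beyond all odd sites of the
   earlier one. *)
Lemma odd_pattern_pair s x h h' : odd (count_mem x s) -> (h < h')%N ->
  E (fun n => mu_prod s (n + h) * mu_prod s (n + h')) = 0.
Proof.
move=> ox hh; have ex : exists x, odd (count_mem x s) by exists x.
have ub y : odd (count_mem y s) -> (y <= sumn s)%N.
  move=> oy; have ys : y \in s by rewrite -has_pred1 has_count; case: count oy.
  by rewrite (perm_sumn (perm_to_rem ys)) /= leq_addr.
case: (ex_maxnP ex ub) => {ox ex ub}x ox xmax.
rewrite -[RHS](odd_pattern HS HE (s := [seq (h + i)%N | i <- s] ++ [seq (h' + i)%N | i <- s]) (x := (h' + x)%N)).
  by apply: eq_lm => n; rewrite mu_prod_cat -!mu_prod_shift.
rewrite count_cat oddD count_shift ox addbT.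
have -> : (h' + x = h + (h' - h + x))%N by lia.
rewrite count_shift; apply/negP => /xmax; lia.
Qed.

(* Replacing mu_prod s by its moving average B over H terms does not change the
   Cesaro averages asymptotically, and E (B ^ 2) <= 1 / H. *)
Lemma lm_avg_sq s x : odd (count_mem x s) -> E (fun N => avg (mu_prod s) N ^+ 2) = 0.
Proof.
move=> ox; set C := @mu_prod R s.
have C1 n : `|C n| <= 1 by exact: mu_prod_le1.
have bC : bdd C by exists 1.
have bA g : (forall n, `|g n| <= 1) -> bdd (fun N => avg g N ^+ 2 : R).
  by move=> Hg; apply: bddX; exists 1 => N; exact: avg_norm_le.
apply/eqP; rewrite eq_le; apply/andP; split; last first.
  by apply: (lm_ge0 HE) => [|n]; [exact: bA|exact: sqr_ge0].
apply/ler_addgt0Pr => d d0; rewrite add0r.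
have [H HH] := exists_nat_gt (d^-1).
have HR : 0 < H%:R :> R by rewrite (lt_trans _ HH) // invr_gt0.
pose B n : R := H%:R^-1 * \sum_(h < H) C (n + h)%N.
have bCh h : bdd (fun n => C (n + h)%N) by exact: (bdd_comp (fun n => n + h)%N).
have bB : bdd B by apply: bddM => //; exact: bdd_sum.
have B1 n : `|B n| <= 1.
  rewrite /B normrM gtr0_norm ?invr_gt0 // ler_pdivrMl // mulr1.
  rewrite (le_trans (ler_norm_sum _ _ _)) // (le_trans (ler_sum _ (fun (h : 'I_H) _ => C1 (n + h)%N))) //.
  by rewrite sumr_const card_ord.
have avgB N : `|avg B N - avg C N| <= 2 * H%:R / N%:R.
  have -> : avg B N - avg C N = H%:R^-1 * \sum_(h < H) (avg (fun n => C (n + h)%N) N - avg C N).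
    rewrite sumrB sumr_const card_ord -[avg C N *+ H]mulr_natl mulrBr mulKf ?gt_eqF //.
    congr (_ - _); rewrite /avg -!mulr_sumr [RHS]mulrCA; congr (_ * _).
    by rewrite exchange_big /= mulr_sumr.
  rewrite normrM gtr0_norm ?invr_gt0 // ler_pdivrMl // (le_trans (ler_norm_sum _ _ _)) //.
  apply: (@le_trans _ _ (\sum_(h < H) 2 * H%:R / N%:R)).
    apply: ler_sum => h _; rewrite (le_trans (avg_shift_le _ _ C1)) //.
    by rewrite ler_wpM2r ?invr_ge0 // ler_pM2l // ler_nat ltnW.
  by rewrite sumr_const card_ord -[leLHS]mulr_natl.
have E1 : E (fun N => avg C N ^+ 2) = E (fun N => avg B N ^+ 2).
  apply/eqP; rewrite -subr_eq0 -(lmB HE); [apply/eqP|exact: bA|exact: bA].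
  apply: (lm_cvg0 HE); first by apply: bddD; [exact: bA|apply: bddN; exact: bA].
  apply/cvgrPdist_le => e e0; exists (Num.truncn (4 * H%:R / e)).+1 => // N /= HN.
  rewrite sub0r normrN.
  have NR : 4 * H%:R / e <= N%:R.
    by rewrite (le_trans (ltW (truncnS_gt _))) // ler_nat.
  have N0 : 0 < N%:R :> R by rewrite ltr0n; case: N HN {NR}.
  have -> : avg C N ^+ 2 - avg B N ^+ 2 = - ((avg B N - avg C N) * (avg B N + avg C N)) by ring.
  rewrite normrN normrM.
  have h1 : `|avg B N + avg C N| <= 2.
    by rewrite (le_trans (ler_normD _ _)) // -[leRHS]/(1 + 1) lerD ?avg_norm_le.
  apply: (@le_trans _ _ (2 * H%:R / N%:R * 2)); first by rewrite ler_pM.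
  rewrite mulrAC ler_pdivrMr // -ler_pdivrMl // mulrC (le_trans _ NR) //.
  by rewrite ler_pM2r ?invr_gt0 //; lra.
(* The square moves inside the Cesaro average, which [lm_avg] then removes. *)
rewrite E1 (@le_trans _ _ (E (fun N => avg (fun n => B n ^+ 2) N))) //.
  apply: (lm_mono HE); [exact: bA|by apply: bdd_avg; exact: bddX|exact: avg_sq_le].
rewrite (lm_avg HE); last exact: bddX.
have -> : E (fun n => B n ^+ 2) = H%:R^-1 ^+ 2 * \sum_(h < H) \sum_(h' < H) E (fun n => C (n + h)%N * C (n + h')%N).
  rewrite (eq_bigr (fun h : 'I_H => E (fun n => \sum_(h' < H) C (n + h)%N * C (n + h')%N))) => [|h _]; last first.
    by rewrite (lm_sum HE) // => h'; exact: bddM.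
  rewrite -(lm_sum HE); last by move=> h; apply: bdd_sum => h'; exact: bddM.
  rewrite -(lmZ HE); last by apply: bdd_sum => h; apply: bdd_sum => h'; exact: bddM.
  apply: eq_lm => n; rewrite /B exprMn; congr (_ * _); rewrite expr2 mulr_suml.
  by apply: eq_bigr => h _; rewrite mulr_sumr.
(* Only the H diagonal pairs survive, each at most 1. *)
apply: (@le_trans _ _ (H%:R^-1 ^+ 2 * H%:R)).
  rewrite ler_wpM2l ?sqr_ge0 // -[X in _ <= X%:R](card_ord H) -sumr_const.
  apply: ler_sum => h _; rewrite (bigD1 h) //= big1 => [|h' hh].
    rewrite addr0 -[leRHS](lm_cst HE); apply: (lm_mono HE) => // [|n]; first exact: bddM.
    by rewrite (le_trans (ler_norm _)) // normrM mulr_ile1.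
  have [lt|gt|/val_inj e] := ltngtP h h'; last by rewrite e eqxx in hh.
    exact: (odd_pattern_pair ox lt).
  rewrite -[RHS](odd_pattern_pair ox gt); apply: eq_lm => n; exact: mulrC.
rewrite expr2 -mulrA mulVf ?gt_eqF // mulr1 ltW //.
by rewrite -[ltRHS]invrK ltf_pV2 ?posrE ?invr_gt0.
Qed.

End AvgSquare.

(** * Simultaneous smallness and the diagonal sequence *)

Definition odd_seq (s : seq nat) := has (fun x => odd (count_mem x s)) s.

Lemma odd_seqP s x : odd (count_mem x s) -> odd_seq s.
Proof.
move=> ox; apply/hasP; exists x => //.
by rewrite -has_pred1 has_count; case: count ox.
Qed.

(** Otherwise the sum of the squared averages over L would be at least e^2 from N0 on, although its
    mean is 0. *)
Lemma joint_chowla (R : realType) : sarnak R ->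
  forall (L : seq (seq nat)) (e : R) N0, 0 < e -> all odd_seq L ->
  exists2 N, (N0 <= N)%N & forall s, s \in L -> `|avg (mu_prod s) N| <= e.
Proof.
move=> HS L e N0 e0 /allP HL; apply: contrapT => H.
have [|E HE _] := @logmean_along R setT; first by move=> n; exists n.
have e2 : 0 < e ^+ 2 by rewrite exprn_gt0.
have bA s : bdd (fun N => avg (@mu_prod R s) N ^+ 2).
  by apply: bddX; exists 1 => N; apply: avg_norm_le => n; exact: mu_prod_le1.
have E0 : E (fun N => \sum_(s <- L) avg (mu_prod s) N ^+ 2) = 0.
  rewrite (lm_sum HE) // big_seq big1 // => s /HL /hasP[x _ ox].
  exact: (lm_avg_sq HS HE ox).
suff : e ^+ 2 <= E (fun N => \sum_(s <- L) avg (mu_prod s) N ^+ 2).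
  by rewrite E0 leNgt e2.
pose f N : R := if (N0 <= N)%N then e ^+ 2 else 0.
have bf : bdd f.
  by exists (e ^+ 2) => N; rewrite /f; case: ifP; rewrite ?normr0 ?ger0_norm // ltW.
rewrite -[leLHS](lm_cst HE) (lm_eventually HE (g := f) (N0 := N0)) //; last by move=> N; rewrite /f => ->.
apply: (lm_mono HE) => //; first exact: bdd_sum.
move=> N; rewrite /f; case: ifP => [NN|_]; last by apply: sumr_ge0 => s _; exact: sqr_ge0.
have [s sL hs] : exists2 s, s \in L & e < `|avg (mu_prod s) N|.
  apply: contrapT => H'; apply: H; exists N => // s sL; rewrite leNgt.
  by apply/negP => hs; apply: H'; exists s.
rewrite (big_rem s) //= -[leLHS]addr0 lerD //; last by apply: sumr_ge0 => t _; exact: sqr_ge0.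
by rewrite -[leRHS](real_normK (num_real _)) lerXn2r ?nnegrE ?(ltW e0) // ltW.
Qed.

Definition chowla_sites k (a : 'I_k -> nat) (j0 : nat) (j : 'I_k -> nat) : seq nat :=
  nseq j0 0%N ++ flatten [seq nseq (j t) (a t) | t <- enum 'I_k].

Lemma chowla_term_mu_prod (R : realType) k (a : 'I_k -> nat) j0 (j : 'I_k -> nat) n :
  (chowla_term a j0 j n)%:~R = @mu_prod R (chowla_sites a j0 j) n.
Proof.
have P x i : mu_prod (nseq i x) n = mu (n + x) ^+ i :> R.
  by elim: i => [|i IH]; rewrite /mu_prod ?big_nil //= big_cons -/(mu_prod _ _) IH exprS.
rewrite mu_prod_cat P addn0 /chowla_term rmorphM rmorphXn rmorph_prod /=; congr (_ * _).
rewrite /mu_prod big_flatten big_map big_enum /=; apply: eq_bigr => t _.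
by rewrite -/(mu_prod _ _) P rmorphXn.
Qed.

(** The sites 0 < a_1 < ... < a_k are distinct, so the multiplicity of each is exactly its
    exponent. *)
Lemma chowla_sites_odd k (a : 'I_k -> nat) j0 (j : 'I_k -> nat) :
  (forall t, (1 <= a t)%N) -> (forall s t : 'I_k, (s < t)%N -> (a s < a t)%N) ->
  (j0 == 1%N) || [exists t, j t == 1%N] -> odd_seq (chowla_sites a j0 j).
Proof.
move=> a1 amono.
have cnt x : count_mem x (chowla_sites a j0 j) =
    ((0 == x)%N * j0 + \sum_(t < k) (a t == x)%N * j t)%N.
  rewrite count_cat count_nseq count_flatten sumnE 2!big_map big_enum /=; congr (_ + _)%N.
  by apply: eq_bigr => t _; rewrite count_nseq.
have ainj s t : a s = a t -> s = t.
  by move=> st; apply: val_inj; case: (ltngtP s t) => // /amono; rewrite st ltnn.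
case/orP => [/eqP j01|/existsP[t /eqP jt]].
  apply: (@odd_seqP _ 0%N); rewrite cnt j01 big1 // => t _.
  by rewrite gtn_eqF // a1.
apply: (@odd_seqP _ (a t)); rewrite cnt ltn_eqF ?a1 // (bigD1 t) //= eqxx jt big1 // => s st.
by rewrite (_ : (a s == a t) = false) //; apply: contraNF st => /eqP/ainj ->.
Qed.

Theorem theorem1p1 (R : realType) : sarnak R ->
  exists Ns : nat -> nat,
    (forall i, (0 < Ns i)%N) /\ (forall i, (Ns i < Ns i.+1)%N) /\
    forall (k : nat) (a : 'I_k -> nat) (j0 : nat) (j : 'I_k -> nat),
      (forall t, (1 <= a t)%N) ->
      (forall s t : 'I_k, (s < t)%N -> (a s < a t)%N) ->
      (j0 == 1%N) || (j0 == 2%N) ->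
      (forall t, (j t == 1%N) || (j t == 2%N)) ->
      (j0 == 1%N) || [exists t, j t == 1%N] ->
      (fun i => avg (fun n => (chowla_term a j0 j n)%:~R) (Ns i)) @ \oo
        --> (0 : R).
Proof.
move=> HS.
(* Patterns are finite sequences, hence countable: stage i treats all odd patterns with code at most
   i, with error 1 / (i + 1). *)
pose pat i : seq nat := odflt [::] (unpickle i).
pose L i := [seq s <- map pat (iota 0 i.+1) | odd_seq s].
have /choice[NN HN] : forall iB : nat * nat, exists N, (iB.2 <= N)%N /\
    forall s, s \in L iB.1 -> `|avg (@mu_prod R s) N| <= iB.1.+1%:R^-1.
  move=> [i B]; have [||N h1 h2] := joint_chowla HS (L := L i) (e := i.+1%:R^-1) B.
  - by rewrite invr_gt0.
  - by apply/allP => s; rewrite mem_filter => /andP[].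
  by exists N.
(* The lower bound passed to [NN] makes the sequence strictly increasing, and the initial 1 makes it
   positive. *)
pose Ns := fix Ns i := if i is i'.+1 then NN (i, (Ns i').+1) else NN (0, 1)%N.
have Ns_lt i : (Ns i < Ns i.+1)%N by have [] := HN (i.+1, (Ns i).+1).
exists Ns; split; [|split=> //].
  by case=> [|i]; [have [] := HN (0, 1)%N|exact: leq_ltn_trans (Ns_lt i)].
move=> k a j0 j a1 amono _ _ hodd.
set s := chowla_sites a j0 j.
have so : odd_seq s by exact: chowla_sites_odd.
have -> : (fun n => (chowla_term a j0 j n)%:~R) = @mu_prod R s.
  by apply/funext => n; exact: chowla_term_mu_prod.
apply/cvgrPdist_le => e e0.
exists (maxn (pickle s) (Num.truncn e^-1).+1) => // i /=; rewrite geq_max => /andP[si ei].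
have sL : s \in L i.
  rewrite mem_filter so; apply/mapP; exists (pickle s); last by rewrite /pat pickleK.
  by rewrite mem_iota.
have small : `|avg (@mu_prod R s) (Ns i)| <= i.+1%:R^-1.
  by case: i sL {si ei} => [|i] sL; [have [_ /(_ s)] := HN (0, 1)%N|have [_ /(_ s)] := HN (i.+1, (Ns i).+1)]; apply.
rewrite sub0r normrN (le_trans small) // -[leRHS]invrK lef_pV2 ?posrE ?invr_gt0 //.
by rewrite (le_trans (ltW (truncnS_gt _))) // ler_nat (leq_trans ei).
Qed.
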